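(* Every $n$-dimensional Clifford quantum polynomial algebra $S$ satisfies condition (G1) with $\mathcal P(S)=(E,\sigma)$ such that $\sigma^2=\mathrm{id}$. Moreover, if $S=S^F$ for some normalized sequence $F=(F_1,\dots,F_n)$ of linearly independent symmetric matrices in $M_n(k)$, then $$\Phi:E\to X^{(3)}(F);\quad p\mapsto p*\sigma(p)$$ is (at most) a double cover.
   Context: $k$ is an algebraically closed field of characteristic $0$; all algebras are over $k$. For graded right modules $M,N$ over a connected graded algebra $S$, $\underline{\mathrm{Ext}}^i_S(M,N)=\bigoplus_{j\in\mathbb Z}\mathrm{Ext}^i_{\mathrm{grmod}\,S}(M,N(j))$; $H_S(t)=\sum_i(\dim_k S_i)t^i$. A noetherian connected graded algebra $S$ is an $n$-dimensional quantum polynomial algebra if $\mathrm{gldim}\,S=n$, $\underline{\mathrm{Ext}}^i_S(k,S)\cong k(n)$ for $i=n$ and $0$ for $i\neq n$, and $H_S(t)=(1-t)^{-n}$. Such an algebra is quadratic. For a sequence $F=(F_1,\dots,F_n)$ of linearly independent symmetric matrices in $M_n(k)$, the graded Clifford algebra is $$C(F)=k\langle x_1,\dots,x_n,y_1,\dots,y_n\rangle/\Big(x_ix_j+x_jx_i-\sum_{m=1}^n(F_m)_{ij}y_m,\; x_iy_j-y_jx_i,\; y_iy_j-y_jy_i\Big)_{1\le i,j\le n},$$ with $\deg x_i=1$, $\deg y_j=2$. An $n$-dimensional Clifford quantum polynomial algebra is an $n$-dimensional quantum polynomial algebra isomorphic, as a graded algebra, to some $C(F)$. $F$ is normalized if $(F_i)_{jj}=2\delta_{ij}$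 for all $i,j$. $S^F=k\langle x_1,\dots,x_n\rangle/(x_ix_j+x_jx_i-\sum_{m=1}^n(F_m)_{ij}x_m^2)_{1\le i<j\le n}$. Condition (G1): a quadratic algebra $A=T(V)/(R)$ satisfies (G1) if there is a projective variety (reduced, possibly reducible or empty) $E\subset\mathbb P(V^* )$ and a $k$-automorphism $\sigma$ of $E$ with $\mathcal V(R)=\{(p,\sigma(p))\in\mathbb P(V^* )\times\mathbb P(V^* )\mid p\in E\}$, where $\mathcal V(R)$ is the zero locus of $R$ viewed as bilinear forms; one writes $\mathcal P(A)=(E,\sigma)$. For $S^F$, $\mathbb P(V^* )=\mathbb P^{n-1}$ with homogeneous coordinates $x_1,\dots,x_n$. $X^{(s)}(F)=\{(\lambda_1,\dots,\lambda_n)\in\mathbb P^{n-1}\mid\mathrm{rank}(\lambda_1F_1+\cdots+\lambda_nF_n)<s\}$. For $p=(p_1,\dots,p_n),q=(q_1,\dots,q_n)$, $p*q=(p_1q_1,\dots,p_nq_n)$. ''(At most) a double cover'' means a (well-defined) surjective morphism of varieties all of whose fibers have at most two points. *)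

(* Defs.v *)
(* Right modules over a ring S are left modules over the converse ring S^c: the
   right action m.s is written (s : S^c) *: m. *)
From HB Require Import structures.
From mathcomp Require Import all_boot all_order all_algebra generic_quotient.
From mathcomp Require Import monalg mpoly.

Set Implicit Arguments.
Unset Strict Implicit.
Unset Printing Implicit Defensive.

Import GRing.Theory.
Local Open Scope ring_scope.

Definition left_ideal (R : nzRingType) (I : R -> Prop) : Prop :=
  [/\ I 0, (forall a b, I a -> I b -> I (a + b)) &
      forall a b, I b -> I (a * b)].

Definition left_noetherian (R : nzRingType) : Prop :=
  forall I : R -> Prop, left_ideal I ->
  exists (m : nat) (g : 'I_m -> R),
    forall a, I a <-> exists c : 'I_m -> R, a = \sum_i c i * g i.

Definition noetherian (R : nzRingType) : Prop :=
  left_noetherian R /\ left_noetherian R^c.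

Definition surj (A B : Type) (f : A -> B) : Prop := forall y, exists x, f x = y.

Definition projective (R : nzRingType) (P : lmodType R) : Prop :=
  forall (M N : lmodType R) (g : {linear M -> N}) (f : {linear P -> N}),
    surj g -> exists h : {linear P -> M}, forall x, g (h x) = f x.

(* ... -> P 2 -> P 1 -> P 0 -> M -> 0 is exact *)
Definition resolves (R : nzRingType) (P : nat -> lmodType R)
    (d : forall i, {linear P i.+1 -> P i})
    (M : lmodType R) (e : {linear P 0%N -> M}) : Prop :=
  [/\ surj e,
      (forall x, e x = 0 <-> exists y, x = d 0%N y) &
      forall i x, d i x = 0 <-> exists y, x = d i.+1 y].

Definition pd_le (R : nzRingType) (M : lmodType R) (m : nat) : Prop :=
  exists (P : nat -> lmodType R) (d : forall i, {linear P i.+1 -> P i})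
         (e : {linear P 0%N -> M}),
    [/\ forall i, projective (P i), resolves d e &
        forall i, (m < i)%N -> forall x : P i, x = 0].

(* left global dimension of R; the right one is obtained with R^c *)
Definition gldim_eq (R : nzRingType) (n : nat) : Prop :=
  forall m, (forall M : lmodType R, pd_le M m) <-> (n <= m)%N.

(* The grading S = \bigoplus_(i >= 0) S_i is given by its projections, so that
   S_i = [pred s | ga_pr i s == s]; the last field says S_0 = k. *)
Record connGrAlg (k : fieldType) := ConnGrAlg {
  ga_sort :> algType k;
  ga_pr : nat -> {linear ga_sort -> ga_sort};
  ga_prK : forall i j s, ga_pr i (ga_pr j s) = if i == j then ga_pr i s else 0;
  ga_sum : forall s, exists2 l : seq nat, uniq l & s = \sum_(i <- l) ga_pr i s;
  ga_prM : forall i j s t,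
    ga_pr (i + j)%N (ga_pr i s * ga_pr j t) = ga_pr i s * ga_pr j t;
  ga_pr1 : ga_pr 0%N 1 = 1;
  ga_conn : forall s, exists c : k, ga_pr 0%N s == c%:A }.

Definition homog_part (k : fieldType) (S : connGrAlg k) (i : nat) : {pred S} :=
  [pred s | ga_pr S i s == s].
Arguments homog_part {k} S i.

Definition is_basis (k : fieldType) (V : lmodType k) (W : {pred V})
    (m : nat) (b : 'I_m -> V) : Prop :=
  (forall i, b i \in W) /\
  forall v, v \in W -> exists! c : 'rV[k]_m, v = \sum_i c 0 i *: b i.

Definition has_dim (k : fieldType) (V : lmodType k) (W : {pred V}) (m : nat) :=
  exists b : 'I_m -> V, is_basis W b.

(* H_S(t) = (1 - t)^-n, that is, H_S(t) (1 - t)^n = 1 as formal power series *)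
Definition hilbert_series_eq (k : fieldType) (S : connGrAlg k) (n : nat) : Prop :=
  exists h : nat -> nat, (forall i, has_dim (homog_part S i) (h i)) /\
    forall i, \sum_(j < i.+1) (h j)%:Z * ((1 - 'X) ^+ n : {poly int})`_(i - j)
              = (i == 0%N)%:Z.

(* finitely generated Z-graded right S-modules *)
Record grmod (k : fieldType) (S : connGrAlg k) := GrMod {
  gm_sort :> lmodType S^c;
  gm_pr : int -> gm_sort -> gm_sort;
  gm_prD : forall i, {morph gm_pr i : x y / x + y};
  gm_prK : forall i j x, gm_pr i (gm_pr j x) = if i == j then gm_pr i x else 0;
  gm_sum : forall x, exists2 l : seq int, uniq l & x = \sum_(i <- l) gm_pr i x;
  gm_prZ : forall i j x (s : S),
    gm_pr (i + j%:Z) ((ga_pr S j s : S^c) *: gm_pr i x)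
    = (ga_pr S j s : S^c) *: gm_pr i x;
  gm_fg : exists (m : nat) (g : 'I_m -> gm_sort),
    forall x, exists c : 'I_m -> S^c, x = \sum_i c i *: g i }.

(* morphisms of grmod S are the linear maps of degree 0 *)
Definition gr_hom (k : fieldType) (S : connGrAlg k) (M N : grmod S)
    (f : M -> N) : Prop :=
  forall i x, f (gm_pr i x) = gm_pr i (f x).

Definition gr_projective (k : fieldType) (S : connGrAlg k) (P : grmod S) : Prop :=
  forall (M N : grmod S) (g : {linear M -> N}) (f : {linear P -> N}),
    gr_hom g -> gr_hom f -> surj g ->
    exists2 h : {linear P -> M}, gr_hom h & forall x, g (h x) = f x.

Section Shift.
Variables (k : fieldType) (S : connGrAlg k) (M : grmod S) (r : int).

Definition shift_pr (i : int) : M -> M := gm_pr (i + r).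

Fact shift_prD i : {morph shift_pr i : x y / x + y}.
Proof. exact: gm_prD. Qed.

Fact shift_prK i j x :
  shift_pr i (shift_pr j x) = if i == j then shift_pr i x else 0.
Proof. by rewrite /shift_pr gm_prK (inj_eq (addIr r)). Qed.

Fact shift_sum x : exists2 l : seq int, uniq l & x = \sum_(i <- l) shift_pr i x.
Proof.
have [l ul xE] := gm_sum x; exists [seq i - r | i <- l].
  by rewrite (map_inj_uniq (addIr (- r))).
by rewrite big_map {1}xE; apply: eq_bigr => i _; rewrite /shift_pr subrK.
Qed.

Fact shift_prZ i j x (s : S) :
  shift_pr (i + j%:Z) ((ga_pr S j s : S^c) *: shift_pr i x)
  = (ga_pr S j s : S^c) *: shift_pr i x.
Proof. by rewrite /shift_pr addrAC gm_prZ. Qed.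

(* M(r), with M(r)_i = M_(i + r) *)
Definition shift : grmod S :=
  GrMod shift_prD shift_prK shift_sum shift_prZ (gm_fg M).

End Shift.

Section Regular.
Variables (k : fieldType) (S : connGrAlg k).

Definition reg_pr (i : int) (x : S^c^o) : S^c^o :=
  if i is Posz m then ga_pr S m x else 0.

Fact reg_prD i : {morph reg_pr i : x y / x + y}.
Proof.
case: i => m x y /=; last by rewrite addr0.
exact: (raddfD (ga_pr S m)).
Qed.

Fact reg_prK i j x : reg_pr i (reg_pr j x) = if i == j then reg_pr i x else 0.
Proof.
case: i j => [i|i] [j|j] //=; first exact: ga_prK.
- exact: (raddf0 (ga_pr S i)).
- by case: eqP.
Qed.

Fact reg_sum x : exists2 l : seq int, uniq l & x = \sum_(i <- l) reg_pr i x.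
Proof.
have [l ul xE] := ga_sum (x : S); exists (map Posz l).
  by rewrite map_inj_uniq // => ? ? [].
by rewrite big_map.
Qed.

Fact reg_prZ i j (x : S^c^o) (s : S) :
  reg_pr (i + j%:Z) ((ga_pr S j s : S^c) *: reg_pr i x)
  = (ga_pr S j s : S^c) *: reg_pr i x.
Proof.
case: i => [i|i] /=; first exact: (ga_prM i j (x : S) s).
rewrite scaler0; case: (_ + _) => //= m; exact: (raddf0 (ga_pr S m)).
Qed.

Fact reg_fg : exists (m : nat) (g : 'I_m -> S^c^o),
  forall x, exists c : 'I_m -> S^c, x = \sum_i c i *: g i.
Proof.
exists 1%N; exists (fun=> 1); move=> x; exists (fun=> x).
by rewrite big_ord1 -[RHS]/(x * 1 : S^c) mulr1.
Qed.

Definition regular_grmod : grmod S :=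
  GrMod reg_prD reg_prK reg_sum reg_prZ reg_fg.

End Regular.

Section Trivial.
Variables (k : fieldType) (S : connGrAlg k).

(* augmentation S -> S_0 = k *)
Definition aug (s : S) : k := xchoose (ga_conn s).

Fact augE s : (aug s)%:A = ga_pr S 0%N s.
Proof. by have /eqP-> := xchooseP (ga_conn s). Qed.

Fact aug_inj : injective (fun c : k => c%:A : S).
Proof. exact: (fmorph_inj (in_alg S)). Qed.

Fact augD : {morph aug : s t / s + t}.
Proof. by move=> s t; apply: aug_inj; rewrite /= scalerDl !augE raddfD. Qed.

Fact aug1 : aug 1 = 1.
Proof. by apply: aug_inj; rewrite /= augE ga_pr1 scale1r. Qed.

Fact ga_pr0M s t : ga_pr S 0%N (s * t) = ga_pr S 0%N s * ga_pr S 0%N t.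
Proof.
have pr0M i j : ga_pr S 0 (ga_pr S i s * ga_pr S j t)
   = ga_pr S 0 (ga_pr S i s) * ga_pr S 0 (ga_pr S j t).
  rewrite -{1}(ga_prM i j) !ga_prK.
  case: i j => [|i] [|j] /=; rewrite ?mul0r ?mulr0 //.
  by rewrite (ga_prM 0 0).
have [l _ sE] := ga_sum s; have [m _ tE] := ga_sum t.
have -> : s * t = \sum_(i <- l) \sum_(j <- m) ga_pr S i s * ga_pr S j t.
  by rewrite {1}sE mulr_suml; apply: eq_bigr => i _; rewrite {1}tE mulr_sumr.
rewrite {2}sE {2}tE !raddf_sum mulr_suml.
apply: eq_bigr => i _; rewrite raddf_sum mulr_sumr.
by apply: eq_bigr => j _; apply: pr0M.
Qed.

Fact augM : {morph aug : s t / s * t}.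
Proof.
move=> s t; apply: aug_inj.
by rewrite /= augE ga_pr0M -!augE -scalerAl mul1r scalerA.
Qed.

Definition triv_mod : Type := k.
HB.instance Definition _ := GRing.Zmodule.on triv_mod.

Definition triv_scale (s : S^c) (c : triv_mod) : triv_mod := (c : k) * aug s.

Fact triv_scaleA a b v : triv_scale a (triv_scale b v) = triv_scale (a * b) v.
Proof. by rewrite /triv_scale -mulrA -augM. Qed.
Fact triv_scale1 : left_id 1 triv_scale.
Proof. by move=> v; rewrite /triv_scale aug1 mulr1. Qed.
Fact triv_scaleDr : right_distributive triv_scale +%R.
Proof. by move=> a u v; apply: mulrDl. Qed.
Fact triv_scaleDl v : {morph triv_scale^~ v : a b / a + b}.
Proof. by move=> a b; rewrite /triv_scale augD mulrDr. Qed.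

HB.instance Definition _ := GRing.Zmodule_isLmodule.Build S^c triv_mod
  triv_scaleA triv_scale1 triv_scaleDr triv_scaleDl.

Definition triv_pr (i : int) (x : triv_mod) : triv_mod := if i == 0 then x else 0.

Fact triv_prD i : {morph triv_pr i : x y / x + y}.
Proof. by move=> x y; rewrite /triv_pr; case: eqP => // _; rewrite addr0. Qed.

Fact triv_prK i j x : triv_pr i (triv_pr j x) = if i == j then triv_pr i x else 0.
Proof.
rewrite /triv_pr; case: (eqVneq i 0) => [->|]; last by case: ifP.
by rewrite eq_sym.
Qed.

Fact triv_sum x : exists2 l : seq int, uniq l & x = \sum_(i <- l) triv_pr i x.
Proof. by exists [:: 0]; rewrite // big_seq1. Qed.

Fact triv_prZ i j x (s : S) :
  triv_pr (i + j%:Z) ((ga_pr S j s : S^c) *: triv_pr i x)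
  = (ga_pr S j s : S^c) *: triv_pr i x.
Proof.
rewrite /triv_pr; case: (eqVneq i 0) => [->|_]; last by rewrite scaler0 if_same.
rewrite add0r; case: j => [|j] //=; rewrite -[LHS]/(0 : k) -[RHS]/(x * _ : k).
suff -> : aug (ga_pr S j.+1 s) = 0 by rewrite mulr0.
by apply: aug_inj; rewrite /= augE ga_prK scale0r.
Qed.

Fact triv_fg : exists (m : nat) (g : 'I_m -> triv_mod),
  forall x, exists c : 'I_m -> S^c, x = \sum_i c i *: g i.
Proof.
exists 1%N; exists (fun=> (1 : k)); move=> x; exists (fun=> (x : k)%:A : S).
rewrite big_ord1 -[RHS]/(1 * _ : k) mul1r; apply: aug_inj.
by rewrite /= augE linearZ /= ga_pr1.
Qed.

(* k = S / S_(>= 1) *)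
Definition triv_grmod : grmod S :=
  GrMod triv_prD triv_prK triv_sum triv_prZ triv_fg.

End Trivial.

Section Ext.
Variables (k : fieldType) (S : connGrAlg k).
Variables (P : nat -> grmod S) (d : forall i, {linear P i.+1 -> P i}).
Variable N : grmod S.

Definition ext_cocycle (i : nat) (f : {linear P i -> N}) : Prop :=
  gr_hom f /\ forall x, f (d i x) = 0.

Definition ext_coboundary (i : nat) : (P i -> N) -> Prop :=
  match i with
  | 0 => fun f => forall x, f x = 0
  | j.+1 => fun f => exists2 g : {linear P j -> N},
      gr_hom g & forall x, f x = g (d j x)
  end.
End Ext.

(* dim_k Ext^i_(grmod S)(M, N) = m, computed as the i-th cohomology of
   Hom_(grmod S)(P, N) for a projective resolution P of M in grmod S *)
Definition ext_dim (k : fieldType) (S : connGrAlg k) (M N : grmod S)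
    (i m : nat) : Prop :=
  exists (P : nat -> grmod S) (d : forall i, {linear P i.+1 -> P i})
         (e : {linear P 0%N -> M}),
    [/\ forall i, gr_projective (P i) /\ gr_hom (d i),
        gr_hom e,
        @resolves S^c P d M e &
        exists2 b : 'I_m -> {linear P i -> N},
          forall r, ext_cocycle d (b r) &
          forall f : {linear P i -> N}, ext_cocycle d f ->
          exists! c : 'rV[k]_m,
            ext_coboundary d
              (fun x => f x - \sum_r ((c 0 r)%:A : S^c) *: b r x)].

(* k(n) is k in degree - n: Ext^i_(grmod S)(k, S(j)) is one-dimensional if
   i = n and j = - n, and zero otherwise. *)
Record quantum_poly (k : fieldType) (n : nat) (S : connGrAlg k) : Prop := {
  qp_noetherian : noetherian S;
  qp_gldim : gldim_eq S^c n;
  qp_ext : forall (i : nat) (j : int),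
    ext_dim (triv_grmod S) (shift (regular_grmod S) j) i
            ((i == n) && (j == - n%:Z));
  qp_hilbert : hilbert_series_eq S n }.

Notation freeAlg k I := {malg k[{fmonom I}]}.

Definition gen (k : fieldType) (I : choiceType) (i : I) : freeAlg k I :=
  << fmu i >>.

(* the algebra morphism sending the generator i to u i *)
Definition feval (k : fieldType) (I : choiceType) (A : algType k) (u : I -> A)
    (f : freeAlg k I) : A :=
  monalg.mmap (in_alg A) (fun w : {fmonom I} => \prod_(i <- (w : seq I)) u i) f.

Definition in_ideal (A : nzRingType) (rel : A -> Prop) (f : A) : Prop :=
  exists (m : nat) (a r b : 'I_m -> A),
    (forall i, rel (r i)) /\ f = \sum_i a i * r i * b i.

(* u induces an isomorphism k<I> / (rel) -> A: the evaluation at u is onto, with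
   kernel the two-sided ideal generated by rel *)
Definition presents (k : fieldType) (I : choiceType) (A : algType k)
    (rel : freeAlg k I -> Prop) (u : I -> A) : Prop :=
  surj (feval u) /\ forall f, feval u f = 0 <-> in_ideal rel f.

Section Clifford.
Variables (k : fieldType) (n : nat).
Implicit Types (F : n.-tuple 'M[k]_n) (S : connGrAlg k).

Definition lin_indep_symmetric F : Prop :=
  free F /\ forall m, (tnth F m)^T = tnth F m.

Definition normalized F : Prop :=
  forall i j : 'I_n, tnth F i j j = 2 *+ (i == j).

Local Notation X i := (gen k (inl i : 'I_n + 'I_n)).
Local Notation Y i := (gen k (inr i : 'I_n + 'I_n)).

Inductive clifford_rel F : freeAlg k ('I_n + 'I_n)%type -> Prop :=
| clifford_xx i j :
    clifford_rel F (X i * X j + X j * X i - \sum_m tnth F m i j *: Y m)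
| clifford_xy i j : clifford_rel F (X i * Y j - Y j * X i)
| clifford_yy i j : clifford_rel F (Y i * Y j - Y j * Y i).

(* S is isomorphic to C(F) as a graded algebra *)
Definition is_clifford F S : Prop :=
  exists x y : 'I_n -> S,
    [/\ forall i, x i \in homog_part S 1, forall i, y i \in homog_part S 2 &
        presents (clifford_rel F)
          (fun g => match g with inl i => x i | inr i => y i end)].

Definition clifford_quantum_poly S : Prop :=
  quantum_poly n S /\
  exists F, lin_indep_symmetric F /\ is_clifford F S.

Inductive SF_rel F : freeAlg k 'I_n -> Prop :=
| SF_xx (i j : 'I_n) : (i < j)%N ->
    SF_rel F (gen k i * gen k j + gen k j * gen k i
              - \sum_m tnth F m i j *: gen k m ^+ 2).

(* S = S^F, with x the given generators *)
Definition is_SF F S (x : 'I_n -> S) : Prop :=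
  (forall i, x i \in homog_part S 1) /\ presents (SF_rel F) x.

End Clifford.

Section Projective.
Variables (k : fieldType) (n : nat).

Definition nzvec := {v : 'rV[k]_n | v != 0}.

Definition same_line (u v : nzvec) : bool := (val u == val v)%MS.

Fact same_line_equiv : equiv_class_of same_line.
Proof.
split=> [u|u v|v u w]; rewrite /same_line ?submx_refl //; first by rewrite andbC.
move=> /andP[uv vu] /andP[vw wv].
by rewrite (submx_trans uv vw) (submx_trans wv vu).
Qed.
Canonical same_line_equiv_rel := EquivRelPack same_line_equiv.

(* P^(n-1): nonzero vectors of k^n up to scaling *)
Definition projSpace := {eq_quot same_line_equiv_rel}%qT.

Definition rep (p : projSpace) : 'rV[k]_n := val (repr p).

(* v is a vector of homogeneous coordinates of p; in particular v != 0 *)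
Definition coords_of (v : 'rV[k]_n) (p : projSpace) : bool := (v == rep p)%MS.

(* mpoly n k is the type of mpoly.v: monalg.v takes over its notation
   {mpoly k[n]} for another one *)
Definition peval (f : mpoly n k) (v : 'rV[k]_n) : k := f.@[fun i => v 0 i].

(* zero loci of arbitrary sets of homogeneous polynomials; the vanishing of a
   homogeneous f does not depend on the coordinates chosen by rep *)
Definition closed_subset (E : projSpace -> Prop) : Prop :=
  exists I : mpoly n k -> Prop,
    (forall f, I f -> exists e, f \is e.-homog) /\
    forall p, E p <-> forall f, I f -> peval f (rep p) = 0.

End Projective.

Section Varieties.
Variable k : fieldType.

(* f is regular on E: near each point of E it is given by homogeneous
   polynomials of a common degree without common zero *)
Definition morphism_on (n m : nat) (E : projSpace k n -> Prop)
    (f : projSpace k n -> projSpace k m) : Prop :=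
  forall p, E p ->
  exists (U : projSpace k n -> Prop) (e : nat) (g : 'I_m -> mpoly n k),
    [/\ closed_subset (fun q => ~ U q), U p, forall i, g i \is e.-homog &
        forall q, E q -> U q -> coords_of (\row_i peval (g i) (rep q)) (f q)].

(* only the values of s on E matter *)
Definition automorphism_of (n : nat) (E : projSpace k n -> Prop)
    (s : projSpace k n -> projSpace k n) : Prop :=
  exists t : projSpace k n -> projSpace k n,
    [/\ forall p, E p -> E (s p) /\ E (t p),
        forall p, E p -> t (s p) = p /\ s (t p) = p,
        morphism_on E s & morphism_on E t].

Definition hadamard (n : nat) (u v : 'rV[k]_n) : 'rV[k]_n :=
  \row_i (u 0 i * v 0 i).

Definition rank_locus (n s : nat) (F : n.-tuple 'M[k]_n) (p : projSpace k n) :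
    Prop :=
  (\rank (\sum_m rep p 0 m *: tnth F m)%R < s)%N.

(* For a quadratic algebra T(V)/(R), V is the degree 1 part and R is the kernel
   of V (x) V -> S_2.  A basis x of V identifies V (x) V with 'M[k]_n and P(V^* )
   with projSpace k n, a functional having the coordinates of its values on x. *)
Definition quad_relation (S : connGrAlg k) (n : nat) (x : 'I_n -> S)
    (M : 'M[k]_n) : Prop :=
  \sum_i \sum_j M i j *: (x i * x j) = 0.

Definition rel_zero_locus (S : connGrAlg k) (n : nat) (x : 'I_n -> S)
    (p q : projSpace k n) : Prop :=
  forall M, quad_relation x M ->
    \sum_i \sum_j M i j * (rep p 0 i * rep q 0 j) = 0.

(* S satisfies (G1) with P(S) = (E, sigma), in the coordinates x *)
Definition G1_with (S : connGrAlg k) (n : nat) (x : 'I_n -> S)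
    (E : projSpace k n -> Prop) (sigma : projSpace k n -> projSpace k n) : Prop :=
  [/\ closed_subset E, automorphism_of E sigma &
      forall p q, rel_zero_locus x p q <-> E p /\ q = sigma p].

(* Phi : E -> X is a surjective morphism with fibres of at most two points *)
Definition at_most_double_cover (n m : nat) (E : projSpace k n -> Prop)
    (X : projSpace k m -> Prop) (Phi : projSpace k n -> projSpace k m) : Prop :=
  [/\ morphism_on E Phi,
      forall p, E p -> X (Phi p),
      forall l, X l -> exists2 p, E p & Phi p = l &
      forall p1 p2 p3, E p1 -> E p2 -> E p3 -> Phi p1 = Phi p2 -> Phi p2 = Phi p3 ->
        [\/ p1 = p2, p1 = p3 | p2 = p3]].

End Varieties.

(* Main.v *)
(* Let G_1, ..., G_n be the symmetric matrices expressing the anticommutators of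
   the degree one generators. The quadratic relations are exactly the symmetric
   matrices orthogonal to all G_m, so (p, q) lies in their zero locus iff
   p^T q + q^T p is in the span of G. This is symmetric in p and q, hence
   sigma^2 = id once q is determined by p.

   Uniqueness of q uses finite global dimension. If v in S_1 has square zero, a
   twisted derivation D of S with D v = 1 shows that right multiplication by v is
   exact on S; then ker v = im v holds on every module of finite projective
   dimension, which is absurd for k. So the quadrics G_m have no common zero,
   whereas two different partners q, r of p would put p^T q + q^T p and
   p^T r + r^T p in the span and leave only n - 1 quadrics (the square of p and
   n - 2 others) defining the common zeros of G. Over an algebraically closed
   field fewer quadrics than variables always have a common zero: if their ideal
   contains no full graded piece, it lies in a maximal such ideal, which is prime
   and is the ideal of a point; otherwise k[x] would be finite over the subring
   generated by the quadrics, which counting monomials forbids.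

   For normalized F the diagonal of p^T q + q^T p = sum c_m F_m gives c = p * q,
   so Phi maps onto the matrices of rank at most 2 of the span, and the fibre of
   Phi consists of the two linear factors of the corresponding quadratic form. *)
From HB Require Import structures.
Require Import Defs.
From mathcomp Require Import all_boot all_order all_algebra.
From mathcomp Require Import generic_quotient finmap monalg.
From mathcomp Require Import ring.
From mathcomp Require boolp classical_sets.
From Stdlib Require Import Classical ClassicalEpsilon.

Set Implicit Arguments.
Unset Strict Implicit.
Unset Printing Implicit Defensive.

Import GRing.Theory.
Local Open Scope ring_scope.

(** * Modules of finite projective dimension over a square-zero element *)

Section SquareZero.
Variables (R : nzRingType) (v : R).
Hypothesis v_exact : forall s : R, v * s = 0 -> exists t, s = v * t.

Section FreeModule.
Variable P : lmodType R.
Local Open Scope fset_scope.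

(** The canonical map onto [P] from the free module whose basis is the set [P] itself; projectivity
    enters through a section of it. *)
Definition free_sum (g : {malg R[P]}) : P := \sum_(x <- msupp g) g@_x *: x.

Lemma free_sumEw (d : {fset P}) (g : {malg R[P]}) : msupp g `<=` d ->
  free_sum g = \sum_(x <- d) g@_x *: x.
Proof.
move=> le; rewrite [LHS](big_fset_incl _ le) => //= x xd /mcoeff_outdom ->.
by rewrite scale0r.
Qed.

Fact free_sum_linear : linear free_sum.
Proof.
move=> c f g; pose d := msupp (c *: f + g) `|` (msupp f `|` msupp g).
rewrite !(@free_sumEw d) ?fsubsetUl //.
- rewrite scaler_sumr -big_split; apply: eq_bigr => x _ /=.
  by rewrite mcoeffD mcoeffZ scalerDl scalerA.
- by rewrite fsubsetU // fsubsetUr orbT.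
- by rewrite fsubsetU // fsubsetUl orbT.
Qed.
HB.instance Definition _ := GRing.isLinear.Build R {malg R[P]} P *:%R free_sum
  free_sum_linear.

(** A section of [free_sum] moves [x] into a free module, where the exactness of [v] on [R] applies
    to each coordinate; [free_sum] carries the result back to [P]. *)
Lemma projective_exact (x : P) : projective P -> v *: x = 0 -> exists y, x = v *: y.
Proof.
move=> projP vx; have [|h hK] := projP _ _ free_sum (@idfun P).
  move=> y; exists << y >>; rewrite /= (free_sumEw msuppU_le) big_seq_fset1.
  by rewrite mcoeffUU scale1r.
have cE y : exists t, (h x)@_y = v * t.
  by apply: v_exact; rewrite -mcoeffZ -linearZ vx linear0 mcoeff0.
have [c cP] := boolp.choice cE.
exists (\sum_(y <- msupp (h x)) c y *: y); rewrite -[LHS](hK x) scaler_sumr.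
by apply: eq_bigr => y _; rewrite cP scalerA.
Qed.

End FreeModule.

Hypothesis v_sqr0 : v * v = 0.

(* The homology ker v / im v vanishes on projectives and is unchanged under
   passage to syzygies. *)
Lemma pd_le_exact (M : lmodType R) m (x : M) :
  pd_le M m -> v *: x = 0 -> exists y, x = v *: y.
Proof.
move=> [P [d [e [projP [se e0 dE] P0]]]] vx.
(* The claim is the exactness of [v] on the cokernel of [d i]. It holds for [i > m], where
   [P i = 0], and passes from [i.+1] down to [i]; [j] counts these steps. *)
have H i j (p : P i) r : (m < i + j)%N -> v *: p = d i r ->
    exists q r', p = v *: q + d i r'.
  elim: j i p r => [|j IHj] i p r.
    rewrite addn0 => lt _; exists 0, 0; rewrite scaler0 linear0 addr0; exact: P0.
  rewrite addnS -addSn => lt pr.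
  have [r1 vr] : exists r1, v *: r = d i.+1 r1.
    by apply/dE; rewrite linearZ /= -pr scalerA v_sqr0 scale0r.
  have [q [r2 rE]] := IHj _ _ _ lt vr.
  have [|q' pE] := @projective_exact (P i) (p - d i q) (projP i).
    rewrite scalerBr pr rE linearD linearZ /= addrAC subrr add0r.
    by apply/dE; exists r2.
  by exists q', q; rewrite -pE subrK.
have [p pE] := se x.
have /e0[r pr] : e (v *: p) = 0 by rewrite linearZ /= pE.
have [|q [r' pE']] := H 0%N m.+1 p r _ pr; first by rewrite add0n.
exists (e q); rewrite -pE pE' linearD linearZ /=.
by have -> : e (d 0%N r') = 0; [apply/e0; exists r' | rewrite addr0].
Qed.

End SquareZero.
(** * Presented algebras *)

Section FreeAlgebra.
Variables (k : fieldType) (I : choiceType).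

Section Extension.
Variables (B : nzRingType) (phi : {rmorphism k -> B}).
Hypothesis phiC : forall c b, phi c * b = b * phi c.
Variable u : I -> B.

Definition word_prod (w : {fmonom I}) : B := \prod_(i <- (w : seq I)) u i.

Fact word_prod_multiplicative : monalg.mmorphism word_prod.
Proof.
by split=> [w w'|]; rewrite /word_prod ?fmM ?fm1 ?big_cat ?big_nil.
Qed.
HB.instance Definition _ := monalg.isMultiplicative.Build {fmonom I} B word_prod
  word_prod_multiplicative.

(** Coefficients act through a central ring morphism [phi] rather than an algebra structure, so that
    2 by 2 matrices over [S] can serve as values. *)
Definition free_ext : freeAlg k I -> B := monalg.mmap phi word_prod.

Lemma free_extM f g : free_ext (f * g) = free_ext f * free_ext g.
Proof.
have H (g' : {malg k[{fmonom I}]}) m m' : GRing.comm (phi g'@_m) (word_prod m').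
  exact: phiC.
by case: (commr_mmap_is_multiplicative H) => + _; apply.
Qed.

Lemma free_extD f g : free_ext (f + g) = free_ext f + free_ext g.
Proof. exact: mmapD. Qed.

Lemma free_extB f g : free_ext (f - g) = free_ext f - free_ext g.
Proof. exact: mmapB. Qed.

Lemma free_extZ c f : free_ext (c *: f) = phi c * free_ext f.
Proof. exact: mmapZ. Qed.

Lemma free_ext_sum (J : finType) (F : J -> freeAlg k I) :
  free_ext (\sum_j F j) = \sum_j free_ext (F j).
Proof. exact: raddf_sum. Qed.

Lemma free_ext_gen i : free_ext (gen k i) = u i.
Proof.
have -> : free_ext (gen k i) = phi 1 * word_prod (fmu i) by apply: mmapU.
by rewrite rmorph1 mul1r /word_prod fmU big_seq1.
Qed.

Lemma free_ext_gen2 i j : free_ext (gen k i * gen k j) = u i * u j.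
Proof. by rewrite free_extM 2!free_ext_gen. Qed.

Lemma free_ext_comm i j :
  free_ext (gen k i * gen k j - gen k j * gen k i) = u i * u j - u j * u i.
Proof. by rewrite free_extB (free_ext_gen2 i j) (free_ext_gen2 j i). Qed.

Lemma free_ext_lin (J : finType) (c : J -> k) (f : J -> freeAlg k I) :
  free_ext (\sum_j c j *: f j) = \sum_j phi (c j) * free_ext (f j).
Proof. by rewrite free_ext_sum; apply: eq_bigr => j _; rewrite free_extZ. Qed.

Lemma free_ext_anticomm (J : finType) (c : J -> k) (f : J -> freeAlg k I) i j :
  free_ext (gen k i * gen k j + gen k j * gen k i - \sum_l c l *: f l)
  = u i * u j + u j * u i - \sum_l phi (c l) * free_ext (f l).
Proof.
by rewrite free_extB free_extD (free_ext_gen2 i j) (free_ext_gen2 j i) free_ext_lin.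
Qed.

Lemma free_ext_in_ideal (rel : freeAlg k I -> Prop) f :
  (forall r, rel r -> free_ext r = 0) -> in_ideal rel f -> free_ext f = 0.
Proof.
move=> rel0 [m [a [r [b [relr ->]]]]]; rewrite free_ext_sum big1 // => i _.
by rewrite !free_extM (rel0 _ (relr i)) mulr0 mul0r.
Qed.

End Extension.

Lemma in_algC (A : algType k) c (a : A) : in_alg A c * a = a * in_alg A c.
Proof. by rewrite /= mulr_algl mulr_algr. Qed.

Lemma fevalE (A : algType k) (u : I -> A) : feval u = free_ext (in_alg A) u.
Proof. by []. Qed.

Lemma presents_rel (A : algType k) rel (u : I -> A) r :
  presents rel u -> rel r -> feval u r = 0.
Proof.
move=> [_ ker] relr; apply/ker; exists 1%N, (fun=> 1), (fun=> r), (fun=> 1).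
by split=> //; rewrite big_ord1 mulr1 mul1r.
Qed.

(** The universal property without the induced morphism out of [A]: only the vanishing of an
    evaluation is transported. *)
Lemma presents_ext (A : algType k) (rel : freeAlg k I -> Prop) (u : I -> A)
    (B : nzRingType) (phi : {rmorphism k -> B}) (u' : I -> B) f :
  presents rel u -> (forall c b, phi c * b = b * phi c) ->
  (forall r, rel r -> free_ext phi u' r = 0) ->
  feval u f = 0 -> free_ext phi u' f = 0.
Proof. by move=> [_ ker] phiC rel0 /ker; apply: free_ext_in_ideal. Qed.

End FreeAlgebra.

(** * Test algebras truncated above degree two *)

Section TruncatedAlgebra.
Variables (k : fieldType) (n : nat) (N : 'M[k]_n).

(* In the algebra k + V + k z of (n + 2) x (n + 2) matrices the products of the
   degree one elements trunc_gen i are given by an arbitrary bilinear form N. *)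
Let a (i : 'I_n) : 'I_n.+2 := lift ord0 (lift ord_max i).
Definition trunc_top : 'M[k]_n.+2 := delta_mx ord0 ord_max.
Definition trunc_gen (i : 'I_n) : 'M[k]_n.+2 :=
  delta_mx ord0 (a i) + \sum_l N l i *: delta_mx (a l) ord_max.

Let a0 i : (a i == ord0) = false. Proof. by []. Qed.
Let aM i : (ord_max == a i) = false.
Proof.
apply/eqP => /(congr1 val) /=; rewrite /bump /= leqNgt ltn_ord add0n add1n => -[E].
by have := ltn_ord i; rewrite -E ltnn.
Qed.
Let a_inj : injective a. Proof. by move=> i j /lift_inj/lift_inj. Qed.

Lemma trunc_genM i j : trunc_gen i * trunc_gen j = N i j *: trunc_top.
Proof.
rewrite /trunc_gen mulrDl !mulrDr -![_ * _]/(_ *m _).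
rewrite mul_delta_mx_0 ?a0 // add0r [X in _ + (X + _)]mulmx_suml.
rewrite [X in _ + (X + _)]big1 => [|l _]; last first.
  by rewrite -scalemxAl mul_delta_mx_0 // scaler0.
rewrite add0r [X in _ + X]mulmx_suml [X in _ + X]big1 ?addr0 => [|l _]; last first.
  rewrite mulmx_sumr big1 // => l' _.
  by rewrite -scalemxAl -scalemxAr mul_delta_mx_0 ?aM // !scaler0.
rewrite mulmx_sumr (bigD1 i) //= -scalemxAr mul_delta_mx big1 ?addr0 // => l li.
rewrite -scalemxAr mul_delta_mx_0 ?scaler0 //.
by rewrite (inj_eq a_inj) eq_sym.
Qed.

Lemma trunc_gen_top i : trunc_gen i * trunc_top = 0.
Proof.
rewrite mulrDl -![_ * _]/(_ *m _) mul_delta_mx_0 ?a0 // add0r mulmx_suml big1 // => l _.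
by rewrite -scalemxAl mul_delta_mx_0 // scaler0.
Qed.

Lemma trunc_top_gen i : trunc_top * trunc_gen i = 0.
Proof.
rewrite mulrDr -![_ * _]/(_ *m _) mul_delta_mx_0 // add0r mulmx_sumr big1 // => l _.
by rewrite -scalemxAr mul_delta_mx_0 ?aM // scaler0.
Qed.

Lemma trunc_top_sqr : trunc_top * trunc_top = 0.
Proof. exact: mul_delta_mx_0. Qed.

Lemma trunc_gen_entry i l : trunc_gen i ord0 (a l) = (i == l)%:R.
Proof.
rewrite !mxE eqxx (inj_eq a_inj) eq_sym summxE big1 ?addr0 // => j _.
by rewrite !mxE andbC eq_sym aM mulr0.
Qed.

Lemma trunc_gen_free (c : 'I_n -> k) : \sum_i c i *: trunc_gen i = 0 ->
  forall i, c i = 0.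
Proof.
move=> /matrixP s0 i; have := s0 ord0 (a i); rewrite summxE mxE (bigD1 i) //=.
rewrite mxE trunc_gen_entry eqxx mulr1 big1 ?addr0 // => l /negPf li.
by rewrite mxE trunc_gen_entry li mulr0.
Qed.

Lemma trunc_top_neq0 : trunc_top != 0.
Proof.
apply/eqP => /matrixP/(_ ord0 ord_max); rewrite !mxE !eqxx.
by apply/eqP; rewrite oner_eq0.
Qed.

End TruncatedAlgebra.
(** * Quadratic relations *)

Section Anticommutation.
Variables (k : fieldType) (n : nat) (S : connGrAlg k).
Implicit Types (x y : 'I_n -> S) (G : 'I_n -> 'M[k]_n) (M N : 'M[k]_n).

Definition mxdot M N : k := \sum_i \sum_j M i j * N i j.

Lemma mxdotE M N : mxdot M N = \tr (M *m N^T).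
Proof.
apply: eq_bigr => i _; rewrite mxE; apply: eq_bigr => j _; by rewrite mxE.
Qed.

Lemma mxdot_delta M i j : mxdot M (delta_mx i j) = M i j.
Proof.
rewrite /mxdot (bigD1 i) //= (bigD1 j) //= mxE !eqxx mulr1 big1 => [|j' /negPf h].
  rewrite addr0 big1 ?addr0 // => i' /negPf h.
  by rewrite big1 // => j' _; rewrite mxE h mulr0.
by rewrite mxE h andbF mulr0.
Qed.

Lemma mxdotBr M N N' : mxdot M (N - N') = mxdot M N - mxdot M N'.
Proof. by rewrite !mxdotE linearB /= mulmxBr linearB. Qed.

(* R is the orthogonal of the span of G inside the symmetric matrices *)
Definition quad_dual x G : Prop := forall M,
  quad_relation x M <-> M^T = M /\ forall m, mxdot M (G m) = 0.

Definition anticommute x y G : Prop :=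
  forall i j, x i * x j + x j * x i = \sum_m G m i j *: y m.

(** Symmetry of [M] lets twice the sum be regrouped into anticommutators, which expand in the
    [y m]. *)
Lemma anticommute_sum x y G M : M^T = M -> anticommute x y G ->
  (\sum_i \sum_j M i j *: (x i * x j) : S) *+ 2 = \sum_m mxdot M (G m) *: y m.
Proof.
move=> /matrixP Ms ac.
have E : \sum_i \sum_j M i j *: (x i * x j) = \sum_i \sum_j M i j *: (x j * x i) :> S.
  rewrite exchange_big; apply: eq_bigr => i _; apply: eq_bigr => j _.
  by have := Ms i j; rewrite mxE => ->.
transitivity (\sum_i \sum_j \sum_m (M i j * G m i j) *: y m).
  rewrite mulr2n [X in _ + X = _]E -big_split; apply: eq_bigr => i _.
  rewrite -big_split; apply: eq_bigr => j _ /=.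
  by rewrite -scalerDr ac scaler_sumr; apply: eq_bigr => m _; rewrite scalerA.
under eq_bigr do rewrite exchange_big /=; rewrite exchange_big /=.
apply: eq_bigr => m _; rewrite scaler_suml; apply: eq_bigr => i _.
by rewrite scaler_suml.
Qed.

Hypothesis two_neq0 : (2 : k) != 0.

Lemma double_eq0 (s : S) : s *+ 2 = 0 -> s = 0.
Proof.
by move=> s0; rewrite -[s]scale1r -(mulVf two_neq0) -scalerA scaler_nat s0 scaler0.
Qed.

(** Only one inclusion has to be supplied: the other is [anticommute_sum] divided by 2.
    Orthogonality to the antisymmetric matrices amounts to symmetry. *)
Lemma quad_dual_anticommute x y G : anticommute x y G ->
  (forall M, quad_relation x M ->
     (forall N, N^T = - N -> mxdot M N = 0) /\ forall m, mxdot M (G m) = 0) ->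
  quad_dual x G.
Proof.
move=> ac H M; split=> [/H[H1 H2]|[Ms MG]].
  split=> //; apply/matrixP => i j; rewrite mxE -!(mxdot_delta M).
  apply/eqP; rewrite -subr_eq0 -mxdotBr H1 //.
  by rewrite linearB /= !trmx_delta opprB.
by apply: double_eq0; rewrite (anticommute_sum Ms ac) big1 // => m _; rewrite MG scale0r.
Qed.

(** The substitution turns [M] into [B^T *m M *m B], and the adjoint of this map for the trace form
    turns [G m] into [B *m G m *m B^T]. *)
Lemma quad_dual_basis_change x G (B : 'M[k]_n) : B \in unitmx -> quad_dual x G ->
  quad_dual (fun i => \sum_j B i j *: x j) (fun m => B *m G m *m B^T).
Proof.
move=> uB xG M.
have E : quad_relation (fun i => \sum_j B i j *: x j) M
    <-> quad_relation x (B^T *m M *m B).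
  rewrite /quad_relation.
  suff -> : \sum_i \sum_j M i j *: ((\sum_p B i p *: x p) * \sum_q B j q *: x q)
    = \sum_p \sum_q (B^T *m M *m B) p q *: (x p * x q) by [].
  transitivity (\sum_i \sum_j \sum_p \sum_q (M i j * (B i p * B j q)) *: (x p * x q)).
    apply: eq_bigr => i _; apply: eq_bigr => j _.
    rewrite mulr_suml scaler_sumr; apply: eq_bigr => p _.
    rewrite mulr_sumr scaler_sumr; apply: eq_bigr => q _.
    by rewrite -scalerAl -scalerAr !scalerA mulrA.
  under eq_bigr do rewrite exchange_big /=.
  rewrite exchange_big /=; apply: eq_bigr => p _.
  under eq_bigr do rewrite exchange_big /=.
  rewrite exchange_big /=; apply: eq_bigr => q _.
  rewrite mxE scaler_suml exchange_big /=; apply: eq_bigr => j _.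
  rewrite mxE mulr_suml scaler_suml; apply: eq_bigr => i _.
  by rewrite mxE mulrA [M i j * B i p]mulrC.
have uBT : B^T \in unitmx by rewrite unitmx_tr.
have dot m : mxdot M (B *m G m *m B^T) = mxdot (B^T *m M *m B) (G m).
  by rewrite !mxdotE !trmx_mul trmxK !mulmxA mxtrace_mulC !mulmxA.
rewrite E; split=> [/xG[h1 h2]|[h1 h2]].
  split=> [|m]; last by rewrite dot.
  move: h1; rewrite !trmx_mul trmxK mulmxA => /(can_inj (mulmxK uB)).
  by move/(can_inj (mulKmx uBT)).
apply/xG; split=> [|m]; last by rewrite -dot.
by rewrite !trmx_mul trmxK h1 mulmxA.
Qed.

End Anticommutation.

(** * Quadratic relations of graded Clifford algebras *)

Section CliffordFacts.
Variables (k : fieldType) (n : nat) (S : connGrAlg k).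
Variables (F : n.-tuple 'M[k]_n) (x y : 'I_n -> S).
Local Notation xy := (fun g => match g with inl i => x i | inr i => y i end).
Hypothesis Sxy : presents (clifford_rel F) xy.
Local Notation Fm m := (tnth F m).

Lemma clifford_anticommute : anticommute x y (fun m => Fm m).
Proof.
move=> i j; have := presents_rel Sxy (clifford_xx F i j).
rewrite fevalE (free_ext_anticomm (@in_algC k S)) => /eqP.
rewrite subr_eq0 => /eqP ->; apply: eq_bigr => m _.
by rewrite free_ext_gen /= mulr_algl.
Qed.

(** A bilinear form [N] whose symmetrization is the combination of [F] with coefficients [c]
    respects the Clifford relations in the truncated algebra, where [y m] becomes [c m] times the
    top class. *)
Lemma clifford_truncated (N : 'M[k]_n) (c : 'I_n -> k) f :
  (forall i j, N i j + N j i = \sum_m Fm m i j * c m) -> feval xy f = 0 ->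
  free_ext (in_alg 'M[k]_n.+2)
    (fun g => match g with inl i => trunc_gen N i | inr m => c m *: trunc_top k n end)
    f = 0.
Proof.
move=> Nc; apply: (presents_ext Sxy (@in_algC _ _)) => r [] i j.
- rewrite (free_ext_anticomm (@in_algC _ _)) !trunc_genM -scalerDl Nc.
  apply/eqP; rewrite subr_eq0 scaler_suml; apply/eqP/eq_bigr => m _.
  by rewrite free_ext_gen /= mulr_algl scalerA.
- rewrite (free_ext_comm (@in_algC _ _)) -scalerAr -scalerAl trunc_gen_top.
  by rewrite trunc_top_gen !scaler0 subrr.
- rewrite (free_ext_comm (@in_algC _ _)) -!scalerAr -!scalerAl trunc_top_sqr.
  by rewrite !scaler0 subrr.
Qed.

(** The truncated algebra with [N = 0] already separates the generators of degree one. *)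
Lemma clifford_free (c : 'I_n -> k) : \sum_i c i *: x i = 0 -> forall i, c i = 0.
Proof.
move=> sum0; apply: (@trunc_gen_free k n 0).
have := @clifford_truncated 0 (fun=> 0) (\sum_i c i *: gen k (inl i)).
rewrite fevalE !free_ext_lin => H.
rewrite -[RHS]H; first last.
- by rewrite -[RHS]sum0; apply: eq_bigr => i _; rewrite free_ext_gen /= mulr_algl.
- by move=> i j; rewrite !mxE addr0 big1 // => m _; rewrite mulr0.
by apply: eq_bigr => i _; rewrite free_ext_gen /= mulr_algl.
Qed.

Lemma feval_quadric (I : choiceType) (A : algType k) (u : I -> A) (t : 'I_n -> I)
    (M : 'M[k]_n) :
  feval u (\sum_i \sum_j M i j *: (gen k (t i) * gen k (t j)))
  = \sum_i \sum_j M i j *: (u (t i) * u (t j)).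
Proof.
rewrite fevalE free_ext_sum; apply: eq_bigr => i _.
rewrite free_ext_lin; apply: eq_bigr => j _.
by rewrite (free_ext_gen2 (@in_algC _ _)) /= mulr_algl.
Qed.

Lemma trunc_quadric (M N : 'M[k]_n) :
  \sum_i \sum_j M i j *: (trunc_gen N i * trunc_gen N j) = 0 -> mxdot M N = 0.
Proof.
move=> s0; apply/eqP; apply: contraT => nz; case/eqP: (trunc_top_neq0 k n).
rewrite -[LHS]scale1r -(mulVf nz) -scalerA -[mxdot M N *: _](_ : 0 = _) ?scaler0 //.
rewrite -s0 scaler_suml; apply: eq_bigr => i _; rewrite scaler_suml.
by apply: eq_bigr => j _; rewrite trunc_genM scalerA.
Qed.

Lemma clifford_quadric (M N : 'M[k]_n) (c : 'I_n -> k) :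
  (forall i j, N i j + N j i = \sum_m Fm m i j * c m) ->
  quad_relation x M -> mxdot M N = 0.
Proof.
move=> Nc Mx; apply: trunc_quadric.
have := clifford_truncated Nc (f := \sum_i \sum_j M i j *: (gen k (inl i) * gen k (inl j))).
by rewrite -fevalE !feval_quadric; apply.
Qed.

Hypothesis two_neq0 : (2 : k) != 0.
Hypothesis Fsym : forall m, (Fm m)^T = Fm m.

Lemma clifford_quad_dual : quad_dual x (fun m => Fm m).
Proof.
apply: quad_dual_anticommute clifford_anticommute _ => // M Mx; split=> [N NT|m].
  apply: (clifford_quadric (c := fun=> 0)) Mx => i j.
  move/matrixP/(_ j i): NT; rewrite !mxE => ->; rewrite addNr big1 // => m _.
  by rewrite mulr0.
(* The test form [N = F m] has symmetrization [2 F m], so [y m] takes the value 2 and the other [y]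
   the value 0. *)
apply: (clifford_quadric (c := fun m' => (m' == m)%:R *+ 2)) Mx => i j.
rewrite (bigD1 m) //= eqxx big1 ?addr0 => [|m' /negPf->]; last first.
  by rewrite mul0rn mulr0.
by move/matrixP/(_ j i): (Fsym m); rewrite mxE => <-; rewrite mulr_natr mulr2n.
Qed.

End CliffordFacts.

(** * Quadratic relations of [S^F] *)

Section SFFacts.
Variables (k : fieldType) (n : nat) (S : connGrAlg k).
Variables (F : n.-tuple 'M[k]_n) (x : 'I_n -> S).
Hypothesis Sx : presents (SF_rel F) x.
Local Notation Fm m := (tnth F m).
Hypothesis two_neq0 : (2 : k) != 0.
Hypothesis Fsym : forall m, (Fm m)^T = Fm m.
Hypothesis Fnorm : normalized F.

(** The defining relations cover [i < j] and, by symmetry, [j < i]; normalization turns the case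
    [i = j] into the identity [2 x_i^2 = 2 x_i^2]. *)
Lemma SF_anticommute : anticommute x (fun m => x m ^+ 2) (fun m => Fm m).
Proof.
have ac (i j : 'I_n) : (i < j)%N -> x i * x j + x j * x i = \sum_m Fm m i j *: x m ^+ 2.
  move=> ij; have := presents_rel Sx (SF_xx F ij).
  rewrite fevalE (free_ext_anticomm (@in_algC k S)) => /eqP.
  rewrite subr_eq0 => /eqP ->; apply: eq_bigr => m _.
  by rewrite expr2 (free_ext_gen2 (@in_algC k S)) /= mulr_algl expr2.
move=> i j; case: (ltngtP i j) => [/ac//|ji|/val_inj <-].
  rewrite addrC ac //; apply: eq_bigr => m _.
  by move/matrixP/(_ i j): (Fsym m); rewrite mxE => ->.
rewrite (bigD1 i) //= Fnorm eqxx big1 ?addr0 => [|m /negPf mi].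
  by rewrite scaler_nat expr2.
by rewrite Fnorm mi scale0r.
Qed.

(** The square of [x m] replaces [y m], and its value in the truncated algebra is [N m m]; hence the
    diagonal of [N] stands where [clifford_quadric] has the free coefficients [c]. *)
Lemma SF_quadric (M N : 'M[k]_n) :
  (forall i j, N i j + N j i = \sum_m Fm m i j * N m m) ->
  quad_relation x M -> mxdot M N = 0.
Proof.
move=> Nc Mx; apply: trunc_quadric.
have H r : SF_rel F r -> free_ext (in_alg 'M[k]_n.+2) (trunc_gen N) r = 0.
  case=> i j _; rewrite (free_ext_anticomm (@in_algC _ _)) !trunc_genM -scalerDl Nc.
  apply/eqP; rewrite subr_eq0 scaler_suml; apply/eqP/eq_bigr => m _.
  by rewrite expr2 (free_ext_gen2 (@in_algC _ _)) /= trunc_genM mulr_algl scalerA.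
rewrite -[LHS](feval_quadric _ id); apply: (presents_ext Sx (@in_algC _ _) H).
by rewrite feval_quadric.
Qed.

(** Both families of test forms meet the diagonal constraint: an antisymmetric [N] has zero diagonal
    since 2 is invertible, and the diagonal of [F m] is 2 at [m] and 0 elsewhere. *)
Lemma SF_quad_dual : quad_dual x (fun m => Fm m).
Proof.
apply: quad_dual_anticommute SF_anticommute _ => // M Mx; split=> [N NT|m].
  apply: SF_quadric Mx => i j; move/matrixP: NT => NT.
  have := NT j i; rewrite !mxE => ->; rewrite addNr big1 // => m _.
  have := NT m m; rewrite !mxE => /eqP; rewrite -addr_eq0 -mulr2n -mulr_natl.
  by rewrite mulf_eq0 (negPf two_neq0) => /eqP ->; rewrite mulr0.
apply: SF_quadric Mx => i j.
rewrite (bigD1 m) //= Fnorm eqxx big1 ?addr0 => [|m' /negPf m'm]; last first.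
  by rewrite Fnorm eq_sym m'm mulr0.
by move/matrixP/(_ j i): (Fsym m); rewrite mxE => <-; rewrite mulr_natr mulr2n.
Qed.

End SFFacts.
(** * Absence of base points *)

Section UpperTriangular.
Variable B : nzRingType.

(** Triangular matrices encode twisted derivations: by [triM] the corner of a product obeys a
    twisted Leibniz rule. *)
Definition tri (a b d : B) : 'M[B]_2 :=
  \matrix_(i, j) if i == 0 then (if j == 0 then a else b) else if j == 0 then 0 else d.

Lemma triM a b d a' b' d' :
  tri a b d * tri a' b' d' = tri (a * a') (a * b' + b * d') (d * d').
Proof.
apply/matrixP => i j; rewrite !mxE big_ord_recl big_ord1 !mxE /=.
have := ltn_ord i; have := ltn_ord j.
case: i j => [[|[|//]] ?] [[|[|//]] ?] _ _ //=;
  by rewrite -?[_ == 0]/true -?[_ == 0]/false /= ?mul0r ?mulr0 ?addr0 ?add0r.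
Qed.

Lemma triD a b d a' b' d' :
  tri a b d + tri a' b' d' = tri (a + a') (b + b') (d + d').
Proof.
apply/matrixP => i j; rewrite !mxE.
by case: (i == 0); case: (j == 0); rewrite ?addr0.
Qed.

Lemma tri0 : tri 0 0 0 = 0.
Proof. by apply/matrixP => i j; rewrite !mxE !if_same. Qed.

Lemma tri_scalar a : tri a 0 a = a%:M.
Proof.
apply/matrixP => i j; rewrite !mxE.
by case: i j => [[|[|//]] ?] [[|[|//]] ?].
Qed.

Lemma tri_inj a b d a' b' d' :
  tri a b d = tri a' b' d' -> [/\ a = a', b = b' & d = d'].
Proof.
move/matrixP=> h; have := h 0 0; have := h 0 1; have := h 1 1.
by rewrite !mxE /=.
Qed.

Lemma tri_sum (J : finType) (a b d : J -> B) :
  \sum_j tri (a j) (b j) (d j) = tri (\sum_j a j) (\sum_j b j) (\sum_j d j).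
Proof.
apply/matrixP => i j; rewrite summxE !mxE.
under eq_bigr do rewrite mxE.
by case: (i == 0); case: (j == 0) => //; rewrite big1.
Qed.

End UpperTriangular.

(** * A twisted derivation on the Clifford algebra *)

Section CliffordDerivation.
Variables (k : fieldType) (n : nat) (S : connGrAlg k).
Variables (F : n.-tuple 'M[k]_n) (x y : 'I_n -> S).
Local Notation xy := (fun g => match g with inl i => x i | inr i => y i end).
Hypothesis Sxy : presents (clifford_rel F) xy.
Variable p : 'I_n -> k.

Definition scalar2 : k -> 'M[S]_2 := @scalar_mx S 2 \o in_alg S.
HB.instance Definition _ := GRing.RMorphism.on scalar2.

Lemma scalar2E c : scalar2 c = tri c%:A 0 c%:A.
Proof. by rewrite tri_scalar. Qed.

Lemma scalar2C c M : scalar2 c * M = M * scalar2 c.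
Proof.
rewrite -[LHS]/(c%:A%:M *m M) -[RHS]/(M *m c%:A%:M) mul_scalar_mx.
apply/matrixP => i j; rewrite !mxE (bigD1 j) //= big1 => [|l /negPf lj].
  by rewrite mxE eqxx mulr_algl mulr_algr addr0.
by rewrite mxE lj mulr0.
Qed.

Definition derivation_gen (g : 'I_n + 'I_n) : 'M[S]_2 :=
  match g with
  | inl i => tri (x i) (p i)%:A (- x i)
  | inr m => tri (y m) 0 (y m)
  end.

Local Notation rho := (free_ext scalar2 derivation_gen).

Lemma scalar2M c a b d : scalar2 c * tri a b d = tri (c *: a) (c *: b) (c *: d).
Proof. by rewrite scalar2E triM !mulr_algl mul0r addr0. Qed.

(* rho f = [[f, D f], [0, f^]] where f^ is the image of f under the sign
   automorphism and D is the twisted derivation with D x_i = p_i and D y_m = 0. *)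
Lemma derivation_rel r : clifford_rel F r -> rho r = 0.
Proof.
case=> i j.
(* The corner is [x_i p_j - p_i x_j + x_j p_i - p_j x_i]; the sign in the last diagonal entry of the
   generators makes it cancel. *)
- rewrite (free_ext_anticomm scalar2C).
  under eq_bigr do rewrite free_ext_gen scalar2M scaler0.
  rewrite tri_sum /= !triM triD; apply/eqP; rewrite subr_eq0; apply/eqP.
  rewrite -(clifford_anticommute Sxy) big1 // !mulrNN; congr tri.
  by rewrite !mulr_algl !mulr_algr !scalerN addrA subrK subrr.
- rewrite (free_ext_comm scalar2C) /= !triM; apply/eqP; rewrite subr_eq0; apply/eqP.
  have /eqP := presents_rel Sxy (clifford_xy F i j).
  rewrite fevalE (free_ext_comm (@in_algC _ _)) subr_eq0 => /eqP xyC.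
  rewrite mulr0 mul0r add0r addr0 mulNr mulrN xyC; congr tri.
  by rewrite mulr_algl mulr_algr.
- rewrite (free_ext_comm scalar2C) /= !triM; apply/eqP; rewrite subr_eq0; apply/eqP.
  have /eqP := presents_rel Sxy (clifford_yy F i j).
  rewrite fevalE (free_ext_comm (@in_algC _ _)) subr_eq0 => /eqP yyC.
  by rewrite yyC !mulr0 !mul0r.
Qed.

Lemma derivation_feval f : exists d b, rho f = tri (feval xy f) d b.
Proof.
rewrite fevalE /free_ext !mmapE.
elim/big_rec2: _ => [|w s M _ [d [b ->]]]; first by exists 0, 0; rewrite tri0.
have [d' [b' ->]] : exists d b, word_prod derivation_gen w = tri (word_prod xy w) d b.
  rewrite /word_prod; elim/big_rec2: _ => [|g s' M' _ [d' [b' ->]]].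
    by exists 0, 1; rewrite tri_scalar.
  by case: g => i; rewrite triM; do 2 eexists.
rewrite scalar2M triD; do 2 eexists; congr (tri (_ + _) _ _).
by rewrite /= mulr_algl.
Qed.

(** Let [v] be the linear form, so that [D v = 1]. The twisted Leibniz rule reads
    [0 = D(s v) = s - D(s) v], so [t = D(s)] works. *)
Lemma clifford_linear_exact (c : 'I_n -> k) (s : S) : \sum_i c i * p i = 1 ->
  s * (\sum_i c i *: x i) = 0 -> exists t, s = t * (\sum_i c i *: x i).
Proof.
move=> cp; have [f <-] := Sxy.1 s; set v := \sum_i _ => sv.
pose h : freeAlg k ('I_n + 'I_n)%type := \sum_i c i *: gen k (inl i).
have hE : feval xy h = v.
  rewrite fevalE free_ext_lin; apply: eq_bigr => i _.
  by rewrite free_ext_gen /= mulr_algl.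
have rhE : rho h = tri v 1 (- v).
  rewrite free_ext_lin; under eq_bigr do rewrite free_ext_gen scalar2M.
  rewrite tri_sum; congr tri; last by rewrite -sumrN; apply: eq_bigr => i _; rewrite scalerN.
  under eq_bigr do rewrite scalerA; by rewrite -scaler_suml cp scale1r.
have : rho (f * h) = 0.
  apply: (presents_ext Sxy scalar2C derivation_rel).
  by rewrite fevalE (free_extM (@in_algC _ _)) -!fevalE hE.
have [d [b rfE]] := derivation_feval f.
rewrite (free_extM scalar2C) rfE rhE triM -tri0 => /tri_inj[_ + _].
rewrite mulr1 mulrN => /eqP; rewrite subr_eq0 => /eqP ->.
by exists d.
Qed.

End CliffordDerivation.

(** * Absence of common zeros of the defining quadrics *)

Section BasePointFree.
Variables (k : fieldType) (n : nat) (S : connGrAlg k).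
Variables (F : n.-tuple 'M[k]_n) (x y : 'I_n -> S).
Local Notation xy := (fun g => match g with inl i => x i | inr i => y i end).
Hypothesis Sxy : presents (clifford_rel F) xy.
Hypothesis x1 : forall i, x i \in homog_part S 1.
Hypothesis two_neq0 : (2 : k) != 0.

(* If v = sum c_i x_i had square zero then ker v = im v would fail on the
   trivial module, which has finite projective dimension. *)
Lemma clifford_base_point_free m (c : 'I_n -> k) i :
  pd_le (triv_grmod S) m -> c i != 0 ->
  exists l, \sum_i \sum_j c i * c j * tnth F l i j != 0.
Proof.
move=> pd ci; apply: NNPP => nex.
have Fc l : \sum_i \sum_j c i * c j * tnth F l i j = 0.
  by apply/eqP; apply: contraT => nz; case: nex; exists l.
pose v : S := \sum_i c i *: x i.
have v2 : v * v = 0.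
  apply: (double_eq0 two_neq0).
  pose M : 'M[k]_n := \matrix_(i, j) (c i * c j).
  have Ms : M^T = M by apply/matrixP => a b; rewrite !mxE mulrC.
  have -> : v * v = \sum_i \sum_j M i j *: (x i * x j).
    rewrite mulr_suml; apply: eq_bigr => a _; rewrite mulr_sumr.
    by apply: eq_bigr => b _; rewrite mxE -scalerAl -scalerAr scalerA.
  rewrite (anticommute_sum Ms (clifford_anticommute Sxy)) big1 // => l _.
  rewrite [mxdot _ _](_ : _ = 0) ?scale0r // -[RHS](Fc l).
  by apply: eq_bigr => a _; apply: eq_bigr => b _; rewrite mxE.
have aug_v : aug v = 0.
  apply: (@aug_inj k S); rewrite /= augE scale0r /v raddf_sum big1 // => a _.
  by rewrite -(eqP (x1 a)) /= linearZ /= ga_prK scaler0.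
(* The values of the derivation on the generators are chosen so that it sends [v] to 1. *)
pose p l := (l == i)%:R / c i.
have cp : \sum_l c l * p l = 1.
  rewrite (bigD1 i) //= /p eqxx mul1r mulfV // big1 ?addr0 // => l /negPf ->.
  by rewrite mul0r mulr0.
have ex (s : S^c) : (v : S^c) * s = 0 -> exists t : S^c, s = (v : S^c) * t.
  exact: (clifford_linear_exact Sxy cp).
(* Right multiplication in [S] is left multiplication in [S^c]. Since [v] acts by zero on the
   trivial module, exactness would put 1 in a zero image. *)
have [|z zE] := pd_le_exact ex v2 (x := (1 : k) : triv_grmod S) pd.
  by rewrite -[LHS]/((1 : k) * aug v) aug_v mulr0.
move: zE; rewrite -[_ *: _]/((z : k) * aug v) aug_v mulr0 => /eqP.
by rewrite (oner_eq0 k).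
Qed.

End BasePointFree.

(* Imported only here: mpoly and monalg share the names msupp, mcoeff and mmap. *)
From mathcomp Require Import mpoly.

(** * Common zeros of forms *)

Section GradedIdeals.
Variables (k : closedFieldType) (n : nat).
Local Notation A := (mpoly n k).
Implicit Types (f g : A) (J : nat -> A -> Prop) (d e N : nat).

(** A homogeneous ideal is represented by its graded pieces, so 0 lies in every [J d]. *)
Definition graded_ideal J : Prop :=
  [/\ forall d f, J d f -> f \is d.-homog,
      forall d, J d 0,
      forall d f g, J d f -> J d g -> J d (f + g) &
      forall d e f g, J d f -> g \is e.-homog -> J (e + d)%N (g * f)].

Definition full_at J N : Prop := forall f, f \is N.-homog -> J N f.

Lemma homog_ind (P : A -> Prop) d f :
  P 0 -> (forall f g, P f -> P g -> P (f + g)) ->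
  (forall c (m : 'X_{1.. n}), mdeg m = d -> P (c *: 'X_[m])) ->
  f \is d.-homog -> P f.
Proof.
move=> P0 PD PX /dhomogP fd; rewrite [f]mpolyE big_seq.
by apply: (big_ind P) => // m /fd md; apply: PX.
Qed.

Lemma homogS_ind (P : A -> Prop) d f :
  P 0 -> (forall f g, P f -> P g -> P (f + g)) ->
  (forall i g, g \is d.-homog -> P ('X_i * g)) ->
  f \is d.+1.-homog -> P f.
Proof.
move=> P0 PD PX; apply: homog_ind => // c m md.
have [i mi] : exists i, (0 < m i)%N.
  apply/existsP; apply: contraTT (negbT (erefl (0 < 0)%N)).
  rewrite negb_exists => /forallP m0; move: md; rewrite mdegE big1 // => i _.
  by have := m0 i; rewrite lt0n negbK => /eqP.
have -> : m = (U_(i) + (m - U_(i)))%MM by rewrite addmC submK // lep1mP -lt0n.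
rewrite mpolyXD scalerAr; apply: PX; rewrite dhomogZ // dhomogX /=.
have : (mdeg (U_(i) + (m - U_(i))) = d.+1)%N.
  by rewrite addmC submK // lep1mP -lt0n.
by rewrite mdegD mdeg1 add1n => -[->].
Qed.

Lemma full_at_leq J N d : graded_ideal J -> (N <= d)%N ->
  full_at J N -> full_at J d.
Proof.
move=> [_ J0 JD JM] /subnK <- JN; elim: (d - N)%N => // r IHr f.
apply: homogS_ind => // [g h|i g /IHr Jg]; first exact: JD.
by apply: (JM _ 1%N) => //; rewrite dhomogX /= mdeg1.
Qed.

(* A graded ideal containing I and maximal among those that contain no full
   graded piece; it is a homogeneous prime other than the irrelevant ideal. *)
Lemma maximal_graded_ideal (I : nat -> A -> Prop) :
  graded_ideal I -> (forall N, ~ full_at I N) ->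
  exists J, [/\ graded_ideal J, forall d f, I d f -> J d f,
    forall N, ~ full_at J N &
    forall K, graded_ideal K -> (forall d f, J d f -> K d f) ->
      (exists d f, K d f /\ ~ J d f) -> exists N, full_at K N].
Proof.
move=> gI nI.
(* Adjoining [I] makes the empty set, which is the union of the empty chain, stand for [I]
   itself. *)
pose plus (X : classical_sets.set (nat * A)) d f := X (d, f) \/ I d f.
pose P X := graded_ideal (plus X) /\ forall N, ~ full_at (plus X) N.
have [] := @classical_sets.Zorn_bigcup _ P.
  move=> F FP Ftot; have [[X0 FX0]|F0] := classic (exists X, F X); last first.
    have E d f : plus (classical_sets.bigcup F id) d f <-> I d f.
      by split=> [[[X FX _]|//]|]; [case: F0; exists X | right].
    case: gI => I1 I2 I3 I4; split; last first.
      by move=> N h; apply: (nI N) => f /h/E.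
    split=> [d f /E/I1//|d|d f g /E If /E Ig|d e f g /E If hg]; apply/E; auto.
  have E d f : plus (classical_sets.bigcup F id) d f <-> exists2 X, F X & plus X d f.
    split=> [[[X FX Xf]|If]|[X FX [Xf|If]]].
    - by exists X => //; left.
    - by exists X0 => //; right.
    - by left; exists X.
    - by right.
  have Fmax X Y : F X -> F Y -> exists2 Z, F Z & forall d f,
      (plus X d f -> plus Z d f) /\ (plus Y d f -> plus Z d f).
    move=> FX FY; have [s|s] := Ftot _ _ FX FY.
      by exists Y => // d f; split=> // -[/s|]; [left|right].
    by exists X => // d f; split=> // -[/s|]; [left|right].
  split; [split|].
  - by move=> d f /E[X /FP[[+ _ _ _] _]]; apply.
  - by move=> d; apply/E; exists X0 => //; have [[_ + _ _] _] := FP _ FX0; apply.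
  - move=> d f g /E[X FX Xf] /E[Y FY Yg]; apply/E.
    have [Z FZ h] := Fmax _ _ FX FY; exists Z => //.
    have [[_ _ hD _] _] := FP _ FZ.
    by apply: hD; [apply: (proj1 (h d f)) | apply: (proj2 (h d g))].
  - move=> d e f g /E[X FX Xf] hg; apply/E; exists X => //.
    by have [[_ _ _ +] _] := FP _ FX; apply.
  move=> N full.
  (* A full piece of the union is full in a single member of the chain, because there are finitely
     many monomials of degree [N]. *)
  have H (s : seq 'X_{1.. n}) : (forall m, m \in s -> mdeg m = N) ->
      exists2 X, F X & forall m, m \in s -> plus X N 'X_[m].
    elim: s => [|m s IHs] hs; first by exists X0.
    have [X FX hX] : exists2 X, F X & forall m, m \in s -> plus X N 'X_[m].
      by apply: IHs => m' ms; apply: hs; rewrite inE ms orbT.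
    have /full/E[Y FY Ym] : ('X_[m] : A) \is N.-homog.
      by rewrite dhomogX /= hs ?mem_head.
    have [Z FZ h] := Fmax _ _ FX FY; exists Z => // m'.
    rewrite inE => /predU1P[->|/hX Xm']; first exact: (proj2 (h _ _)).
    exact: (proj1 (h _ _)).
  pose s := [seq m <- [seq bmnm m | m : 'X_{1..n < N.+1}] | mdeg m == N].
  have [|X FX hX] := H s; first by move=> m; rewrite mem_filter => /andP[/eqP].
  have [[_ h0 hD hM] /(_ N)] := FP _ FX; apply => f.
  apply: homog_ind => // [g h|c m md]; first exact: hD.
  rewrite -mul_mpolyC; apply: (hM N 0%N); last first.
    by rewrite -[c%:MP]/(c%:MP_[n]) -alg_mpolyC dhomogZ // dhomog1.
  apply: hX; rewrite mem_filter md eqxx /=.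
  have lm : (mdeg m < N.+1)%N by rewrite md.
  by apply/imageP; exists (BMultinom lm).
move=> X [[gX nX] maxX]; exists (plus X); split=> //; first by right.
move=> K gK XK [d [f [Kf nXf]]]; apply: NNPP => nK.
apply: (maxX (fun df => K df.1 df.2)).
  split=> [[e g] Xg|h]; first by apply: XK; left.
  by apply: nXf; left; apply: (h (d, f)).
have E e g : plus (fun df => K df.1 df.2) e g <-> K e g.
  by split=> [[//|Ig]|]; [apply: XK; right | left].
case: gK => K1 K2 K3 K4; split.
  split=> [i g /E/K1//|i|i g h /E Kg /E Kh|i j g h /E Kg hh]; apply/E; auto.
by move=> N h; apply: nK; exists N => g /h/E.
Qed.

End GradedIdeals.

Lemma left_kernel_neq0 (k : fieldType) m n (M : 'M[k]_(m, n)) : (n < m)%N ->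
  exists2 u : 'rV[k]_m, u != 0 & u *m M = 0.
Proof.
move=> lt; have : kermx M != 0.
  rewrite kermx_eq0 /row_free neq_ltn (leq_ltn_trans (rank_leq_col M)) //.
by case/rowV0Pn => u /sub_kermxP uM u0; exists u.
Qed.

(** * From a maximal graded ideal to a point *)

Section MaximalIdeal.
Variables (k : closedFieldType) (n : nat).
Local Notation A := (mpoly n k).
Variable J : nat -> A -> Prop.
Hypothesis gJ : graded_ideal J.
Hypothesis nJ : forall N, ~ full_at J N.
Hypothesis maxJ : forall K, graded_ideal K -> (forall d f, J d f -> K d f) ->
  (exists d f, K d f /\ ~ J d f) -> exists N, full_at K N.
Implicit Types (f g : A) (d e N : nat).

Let JH d f : J d f -> f \is d.-homog. Proof. by case: gJ => + _ _ _; apply. Qed.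
Let J0 d : J d 0. Proof. by case: gJ. Qed.
Let JD d f g : J d f -> J d g -> J d (f + g).
Proof. by case: gJ => _ _ + _; apply. Qed.
Let JM d e c f g : J d f -> g \is e.-homog -> c = (e + d)%N -> J c (g * f).
Proof. by case: gJ => _ _ _ JM ? ? ->; apply: JM. Qed.
Let JZ d c f : J d f -> J d (c *: f).
Proof.
move=> Jf; rewrite -mul_mpolyC; apply: (JM (e := 0) Jf) => //.
by rewrite -alg_mpolyC dhomogZ // dhomog1.
Qed.
Let JB d f g : J d f -> J d g -> J d (f - g).
Proof. by move=> Jf Jg; rewrite -scaleN1r; apply/JD/JZ. Qed.

(** The ideal [J + (a)] is strictly larger than [J], hence full in all large degrees: there every
    form is a multiple of [a] modulo [J]. *)
Lemma maximal_ideal_add e (a : A) : a \is e.-homog -> ~ J e a ->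
  exists N, forall d f, (N <= d)%N -> f \is d.-homog ->
    exists h, h \is (d - e).-homog /\ J d (f - h * a).
Proof.
move=> ha nJa.
(* The subtraction [d - e] truncates at 0, so multiples of [a] in degrees below [e] are excluded
   explicitly. *)
pose K d f := exists h, [/\ h \is (d - e).-homog, (d < e)%N -> h = 0 & J d (f - h * a)].
have gK : graded_ideal K.
  split=> [d f [h [hh h0 Jf]]|d|d f g [h [hh h0 Jf]] [h' [hh' h0' Jg]]|].
  - rewrite -(subrK (h * a) f) dhomogD ?(JH Jf) //.
    have [/h0->|led] := ltnP d e; first by rewrite mul0r dhomog0.
    by rewrite -(subnK led) dhomogM.
  - by exists 0; rewrite dhomog0 mul0r subr0.
  - exists (h + h'); rewrite dhomogD //; split=> //.
      by move=> lt; rewrite h0 // h0' // addr0.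
    by rewrite mulrDl opprD addrACA; apply: JD.
  - move=> d c f g [h [hh h0 Jf]] hg; exists (g * h); split.
    + have [/h0->|led] := ltnP d e; first by rewrite mulr0 dhomog0.
      by rewrite -addnBA // dhomogM.
    + move=> lt; rewrite h0 ?mulr0 //; apply: leq_ltn_trans lt; exact: leq_addl.
    + by rewrite -mulrA -mulrBr; apply: (JM Jf hg).
have [||N KN] := maxJ gK.
- move=> d f Jf; exists 0; rewrite dhomog0 mul0r subr0; by split.
- exists e, a; split=> //; exists 1; rewrite subnn dhomog1 ltnn mul1r subrr.
  by split.
exists N => d f led fd; have [h [hh _ Jf]] := full_at_leq gK led KN fd.
by exists h.
Qed.

(** If neither factor is in [J], a form of large degree is a multiple of [b] modulo [J] with a
    cofactor that is a multiple of [a]. As [a * b] is in [J], this would make [J] full. *)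
Lemma maximal_ideal_prime d e (a b : A) : a \is d.-homog -> b \is e.-homog ->
  J (d + e)%N (a * b) -> J d a \/ J e b.
Proof.
move=> ha hb Jab; apply: NNPP => /not_or_and[nJa nJb].
have [N1 H1] := maximal_ideal_add ha nJa.
have [N2 H2] := maximal_ideal_add hb nJb.
have H c f : (N1 + d <= c)%N -> f \is c.-homog -> J (e + c)%N (b * f).
  move=> lec hf; have [|h [hh Jf]] := H1 c f _ hf.
    by apply: leq_trans lec; apply: leq_addr.
  rewrite -(subrK (h * a) f) mulrDr; apply: JD; first exact: (JM Jf hb).
  have -> : b * (h * a) = h * (a * b) by rewrite mulrC -mulrA.
  apply: (JM Jab hh); rewrite addnA subnK 1?addnC //.
  by apply: leq_trans lec; apply: leq_addl.
(* Degree [D] is at least [N2], and the cofactor of [b], of degree [D - e], still has degree at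
   least [N1 + d]. *)
pose D := (N2 + (e + (N1 + d)))%N.
apply: (nJ (N := D)) => f hf; have [|h [hh Jf]] := H2 D f _ hf; first exact: leq_addr.
rewrite -(subrK (h * b) f); apply: JD => //.
have leD : (e + (N1 + d) <= D)%N by apply: leq_addl.
have -> : D = (e + (D - e))%N by rewrite subnKC //; apply: leq_trans leD; apply: leq_addr.
rewrite mulrC; apply: H => //.
by rewrite leq_subRL //; apply: leq_trans leD; apply: leq_addr.
Qed.

Lemma maximal_ideal_prime_exp d (a : A) r : a \is d.-homog -> ~ J 0 1 ->
  J (r * d)%N (a ^+ r) -> J d a.
Proof.
move=> ha n1; elim: r => [|r IHr]; first by rewrite expr0 mul0n.
rewrite exprS mulSn => /(maximal_ideal_prime ha)[] //.
by rewrite mulnC; apply: dhomogMn.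
Qed.

Let n1 : ~ J 0 1.
Proof.
move=> J1; apply: (nJ (N := 0%N)) => f hf; rewrite -[f]mulr1.
by apply: (JM J1 hf).
Qed.

Let hX i : ('X_i : A) \is 1.-homog. Proof. by rewrite dhomogX /= mdeg1. Qed.

Let hXn i r : ('X_i ^+ r : A) \is r.-homog.
Proof. by rewrite -[X in X.-homog]mul1n; apply: dhomogMn. Qed.

Let J_linear_form : exists i, ~ J 1 'X_i.
Proof.
apply: NNPP => nex; apply: (nJ (N := 1%N)) => f.
apply: homogS_ind => // [f' g|i g hg]; first exact: JD.
rewrite mulrC; apply: (JM _ hg); last by [].
by apply: NNPP => nJi; apply: nex; exists i.
Qed.

Section Point.
Variable i0 : 'I_n.
Hypothesis nJl : ~ J 1 'X_i0.
Local Notation l := ('X_i0 : A).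

(** The binary form of degree [D] in [X_j] and [l] with the coefficients of [q]; terms of [q] above
    [D] are cut off. *)
Definition homogenize (D : nat) (j : 'I_n) (q : {poly k}) : A :=
  \sum_(a < D.+1) q`_a *: ('X_j ^+ a * l ^+ (D - a)).

Lemma homogenize_homog D j (q : {poly k}) : homogenize D j q \is D.-homog.
Proof.
apply: rpred_sum => a _; apply: dhomogZ.
by rewrite -[X in X.-homog](@subnKC a D) -1?ltnS // dhomogM.
Qed.

Lemma homogenize_factor D j (q : {poly k}) c : (size q <= D.+1)%N ->
  homogenize D.+1 j (('X - c%:P) * q) = ('X_j - c *: l) * homogenize D j q.
Proof.
move=> sq; rewrite !mulrBl /homogenize.
under eq_bigr => a _ do rewrite coefB coefCM coefXM scalerBl.
rewrite sumrB big_ord_recl /= scale0r add0r [X in _ - X]big_ord_recr /=.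
rewrite (nth_default 0 sq) mulr0 scale0r addr0 !mulr_sumr; congr (_ - _).
  apply: eq_bigr => a _; rewrite -scalerAr /bump /= add1n subSS exprS mulrA.
  by [].
apply: eq_bigr => a _; rewrite -scalerAl -scalerAr scalerA; congr (_ *: _).
by rewrite mulrCA -exprS subSn // -ltnS.
Qed.

(** Over an algebraically closed field the form splits into factors [X_j - c l] and a power of [l].
    Primeness puts a factor in [J], and [l] is not there. *)
Lemma homogenize_root D j (q : {poly k}) : (size q <= D.+1)%N -> q != 0 ->
  J D (homogenize D j q) -> exists c, J 1 ('X_j - c *: l).
Proof.
elim: D q => [|D IHD] q sq q0.
  rewrite /homogenize big_ord1 !expr0 mulr1 => Jc.
  have c0 : q`_0 != 0.
    apply: contraNneq q0 => q00; rewrite [q]size1_polyC // q00.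
    by rewrite polyC0.
  by case: n1; rewrite -(scale1r 1) -(mulVf c0) -scalerA; apply: JZ.
have [/size_poly1P[c c0 ->]|sq1] := boolP (size q == 1%N).
  rewrite /homogenize big_ord_recl big1 => [|a _]; last first.
    by rewrite coefC scale0r.
  rewrite coefC /= addr0 mul1r => Jc.
  have Jl : J D.+1 (l ^+ D.+1).
    by rewrite -(scale1r (_ ^+ _)) -(mulVf c0) -scalerA; apply: JZ.
  case: nJl; apply: (@maximal_ideal_prime_exp _ _ D.+1) => //.
  by rewrite muln1.
have /closed_rootP[c /factor_theorem[r qE]] := sq1.
have r0 : r != 0 by apply: contraNneq q0 => r0; rewrite qE r0 mul0r.
have sr : (size r <= D.+1)%N by move: sq; rewrite qE size_Mmonic ?monicXsubC // size_XsubC addn2.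
rewrite qE mulrC homogenize_factor // -{1}add1n => Jm.
have [||Jl|Jr] := maximal_ideal_prime _ _ Jm.
- by apply: rpredB; [|apply: dhomogZ]; apply: hX.
- exact: homogenize_homog.
- by exists c.
- exact: IHD Jr.
Qed.

(** Modulo [J], forms of degree at least [N] are forms of degree [N] times powers of [l], so the
    pieces of the quotient have bounded dimension. Hence some nonzero binary form in [X_j] and [l]
    lies in [J], and [homogenize_root] applies. *)
Lemma coordinate_proportional j : exists c, J 1 ('X_j - c *: l).
Proof.
have [N0 HN] := maximal_ideal_add (hX i0) nJl.
have [N HN1] : exists N, forall d f, (N <= d)%N -> f \is d.+1.-homog ->
    exists h, h \is d.-homog /\ J d.+1 (f - h * l).
  exists N0 => d f led hf; have [|h] := HN d.+1 f _ hf; first exact: leqW.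
  by rewrite subn1; exists h.
have HNr r f : f \is (r + N).-homog ->
    exists h, h \is N.-homog /\ J (r + N)%N (f - h * l ^+ r).
  elim: r f => [|r IHr] f hf; first by exists f; rewrite expr0 mulr1 subrr.
  have [h [hh Jh]] := HN1 _ _ (leq_addl r N) hf.
  have [h' [hh' Jh']] := IHr _ hh; exists h'; split=> //.
  rewrite -(subrK (h * l) f) -addrA; apply: JD => //.
  rewrite exprSr mulrA -mulrBl mulrC; exact: (JM Jh' (hX _)).
pose s := [seq m <- [seq bmnm m | m : 'X_{1..n < N.+1}] | mdeg m == N].
(* There are [e] monomials of degree [N], so the [D.+1] forms [h a] of degree [N] obtained below are
   linearly dependent. *)
pose e := size s; pose D := (e + N)%N.
pose f (a : 'I_D.+1) : A := 'X_j ^+ a * l ^+ (D - a).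
have hf a : f a \is D.-homog.
  by rewrite -[X in X.-homog](@subnKC a D) -1?ltnS // dhomogM.
have [h hP] : exists h : 'I_D.+1 -> A, forall a,
    h a \is N.-homog /\ J D (f a - h a * l ^+ e).
  by apply: (fin_all_exists (P := fun a h => h \is _ /\ J D (f a - h * _))) => a; apply: HNr.
have [mu mu0 muC] : exists2 mu : 'rV[k]_D.+1, mu != 0 &
    mu *m (\matrix_(a < D.+1, i < e) (h a)@_(nth 0%MM s i)) = 0.
  by apply: left_kernel_neq0; rewrite ltnS leq_addr.
have hsum : \sum_a mu 0 a *: h a = 0.
  have hh : \sum_a mu 0 a *: h a \is N.-homog.
    by apply: rpred_sum => a _; apply: dhomogZ; case: (hP a).
  apply/mpolyP => m; rewrite mcoeff0.
  have [md|md] := eqVneq (mdeg m) N; last exact: dhomog_nemf_coeff hh md.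
  have ms : m \in s.
    have lm : (mdeg m < N.+1)%N by rewrite md.
    by rewrite mem_filter md eqxx /=; apply/imageP; exists (BMultinom lm).
  have mi : (index m s < e)%N by rewrite index_mem.
  move/matrixP/(_ 0 (Ordinal mi)): muC; rewrite !mxE => muC.
  rewrite raddf_sum /= -[RHS]muC; apply: eq_bigr => a _.
  by rewrite mcoeffZ !mxE /= nth_index.
pose q := \poly_(a < D.+1) mu 0 (inord a).
have qE (a : 'I_D.+1) : q`_a = mu 0 a by rewrite coef_poly ltn_ord inord_val.
apply: (@homogenize_root D j q); first exact: size_poly.
  apply: contraNneq mu0 => q0; apply/eqP/rowP => a.
  by rewrite mxE -qE q0 coef0.
have -> : homogenize D j q = \sum_a mu 0 a *: (f a - h a * l ^+ e).
  transitivity (\sum_a mu 0 a *: f a - (\sum_a mu 0 a *: h a) * l ^+ e).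
    rewrite hsum mul0r subr0; apply: eq_bigr => a _; by rewrite qE.
  rewrite mulr_suml -sumrB; apply: eq_bigr => a _.
  by rewrite scalerBr -[in LHS](scalerAl _ (h a)).
by apply: (big_ind (J D)) => [||a _]; [exact: J0 | exact: JD | apply: JZ; case: (hP a)].
Qed.

End Point.

(** Modulo [J] each coordinate is [c j] times [l], so a form [f] of degree [d] is [f(c) l^d]. No
    power of [l] is in [J], so forms in [J] vanish at [c]. *)
Lemma maximal_ideal_zero : exists2 v : 'rV[k]_n, v != 0 &
  forall d f, J d f -> peval f v = 0.
Proof.
have [i0 nJl] := J_linear_form.
have [c cP] := fin_all_exists (fun j => coordinate_proportional nJl j).
pose l : A := 'X_i0.
have XE (m : 'X_{1.. n}) :
    J (mdeg m) ('X_[m] - (\prod_i c i ^+ m i) *: l ^+ mdeg m).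
  have H (s : seq 'I_n) : J (\sum_(i <- s) m i)%N (\prod_(i <- s) 'X_i ^+ m i
      - (\prod_(i <- s) c i ^+ m i) *: l ^+ (\sum_(i <- s) m i)%N).
    have Hr i r : J r ('X_i ^+ r - c i ^+ r *: l ^+ r).
      elim: r => [|r IHr]; first by rewrite !expr0 scale1r subrr.
      have -> : 'X_i ^+ r.+1 - c i ^+ r.+1 *: l ^+ r.+1
        = 'X_i * ('X_i ^+ r - c i ^+ r *: l ^+ r)
          + (c i ^+ r *: l ^+ r) * ('X_i - c i *: l).
        by rewrite -!mul_mpolyC !exprS mpolyCM; ring.
      apply: JD; first exact: (JM IHr (hX i)).
      by apply: (JM (e := r) (cP i)); rewrite ?addn1 //; apply/dhomogZ/hXn.
    elim: s => [|j s IHs]; first by rewrite !big_nil expr0 scale1r subrr.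
    rewrite !big_cons exprD.
    set u := 'X_j ^+ _; set b := \prod_(_ <- s) 'X_ _ ^+ _.
    move: (Hr j (m j)) IHs; rewrite -/u; set C1 := c j ^+ _; set C2 := \prod_(_ <- s) c _ ^+ m _.
    set d := (\sum_(_ <- _) _)%N; rewrite -/b => Hu Hb.
    have -> : u * b - (C1 * C2) *: (l ^+ m j * l ^+ d)
      = b * (u - C1 *: l ^+ m j) + (C1 *: l ^+ m j) * (b - C2 *: l ^+ d).
      by rewrite -!mul_mpolyC mpolyCM; ring.
    apply: JD; last by apply: (JM Hb); last by []; apply/dhomogZ/hXn.
    apply: (JM Hu (e := d)); last by rewrite addnC.
    by rewrite -(subrK (C2 *: l ^+ d) b); apply: rpredD; [apply: JH | apply/dhomogZ/hXn].
  by have := H (index_enum _); rewrite -mpolyXE_id -mdegE.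
pose v : 'rV[k]_n := \row_i c i.
have vE d f : f \is d.-homog -> J d (f - peval f v *: l ^+ d).
  apply: (@homog_ind k n (fun f => J d (f - peval f v *: l ^+ d))) => [|f' g hf' hg|a m md].
  - by rewrite /peval meval0 scale0r subrr; apply: J0.
  - by rewrite /peval mevalD scalerDl opprD addrACA; apply: JD.
  - rewrite /peval mevalZ mevalX -scalerA -scalerBr -md; apply: JZ.
    by under eq_bigr do rewrite mxE; apply: XE.
have nJlr r : ~ J r (l ^+ r).
  move=> Jr; apply: nJl; apply: (@maximal_ideal_prime_exp _ _ r) => //.
  by rewrite muln1.
have vf d f : J d f -> peval f v = 0.
  move=> Jf; apply/eqP; apply: contraT => nz; case: (nJlr d).
  rewrite -[l ^+ d]scale1r -(mulVf nz) -scalerA; apply: JZ.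
  rewrite -[X in J _ X](subKr f); apply: JB => //.
  exact/vE/JH.
exists v => //; apply/eqP => v0.
case: (nJlr 1%N); rewrite expr1 -[l]subr0.
have <- : c i0 *: l = 0.
  by move/rowP/(_ i0): v0; rewrite !mxE => ->; rewrite scale0r.
exact: cP.
Qed.

End MaximalIdeal.

Lemma graded_ideal_zero (k : closedFieldType) n (I : nat -> mpoly n k -> Prop) :
  graded_ideal I -> (forall N, ~ full_at I N) ->
  exists2 v : 'rV[k]_n, v != 0 & forall d f, I d f -> peval f v = 0.
Proof.
move=> gI nI; have [J [gJ IJ nJ maxJ]] := maximal_graded_ideal gI nI.
by have [v v0 vJ] := maximal_ideal_zero gJ nJ maxJ; exists v => // d f /IJ/vJ.
Qed.

(** * Fewer forms than variables *)

Section CommonZero.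
Variables (k : closedFieldType) (n m : nat).
Local Notation A := (mpoly n k).
Variables (e : nat) (Q : 'I_m -> A).
Hypotheses (e_gt0 : (0 < e)%N) (hQ : forall l, Q l \is e.-homog).

Inductive lin_span (V : lmodType k) (G : V -> Prop) : V -> Prop :=
| lin_span0 : lin_span G 0
| lin_spanD c g f : G g -> lin_span G f -> lin_span G (c *: g + f).

Lemma lin_span_add (V : lmodType k) (G : V -> Prop) f g :
  lin_span G f -> lin_span G g -> lin_span G (f + g).
Proof.
move=> Gf Gg; elim: Gf => [|c h f' Gh _ IH]; first by rewrite add0r.
by rewrite -addrA; apply: lin_spanD.
Qed.

Lemma lin_span_map (V W : lmodType k) (G : V -> Prop) (H : W -> Prop)
    (u : V -> W) f :
  linear u -> (forall g, G g -> H (u g)) -> lin_span G f -> lin_span H (u f).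
Proof.
move=> lu GH; elim=> [|c g f' Gg _ IH]; last first.
  by rewrite lu; apply: lin_spanD => //; apply: GH.
have := lu (-1) 0 0; rewrite scaler0 add0r scaleN1r addNr => ->; exact: lin_span0.
Qed.

Lemma lin_span_fin (V : lmodType k) (G : V -> Prop) (T : finType) (w : T -> V) f :
  (forall g, G g -> exists t, g = w t) -> lin_span G f ->
  exists c : {ffun T -> k}, f = \sum_t c t *: w t.
Proof.
move=> Gw; elim=> [|a g f' /Gw[t ->] _ [c ->]].
  by exists [ffun=> 0]; rewrite big1 // => t _; rewrite ffunE scale0r.
exists [ffun s => (if s == t then a else 0) + c s].
under [RHS]eq_bigr do rewrite ffunE scalerDl.
rewrite big_split /=; congr (_ + _); rewrite (bigD1 t) //= eqxx big1 ?addr0 //.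
by move=> s /negPf->; rewrite scale0r.
Qed.

Definition forms_ideal d (f : A) : Prop := exists h : 'I_m -> A,
  [/\ forall l, h l \is (d - e).-homog, (d < e)%N -> forall l, h l = 0 &
      f = \sum_l h l * Q l].

Lemma forms_ideal_graded : graded_ideal forms_ideal.
Proof.
split=> [d f [h [hh h0 ->]]|d|d f g [h [hh h0 ->]] [h' [hh' h0' ->]]|].
- apply: rpred_sum => l _; have [/h0->|led] := ltnP d e.
    by rewrite mul0r dhomog0.
  by rewrite -(subnK led) dhomogM.
- exists (fun=> 0); split=> // [l|]; first exact: dhomog0.
  by rewrite big1 // => l _; rewrite mul0r.
- exists (fun l => h l + h' l); split=> [l|lt l|]; first exact: dhomogD.
    by rewrite h0 // h0' // addr0.
  by rewrite -big_split; apply: eq_bigr => l _; rewrite mulrDl.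
- move=> d c f g [h [hh h0 ->]] hg; exists (fun l => g * h l); split=> [l|lt l|].
  + have [/h0->|led] := ltnP d e; first by rewrite mulr0 dhomog0.
    by rewrite -addnBA // dhomogM.
  + by rewrite h0 ?mulr0 //; apply: leq_ltn_trans lt; apply: leq_addl.
  + by rewrite mulr_sumr; apply: eq_bigr => l _; rewrite mulrA.
Qed.

Definition form_monomial (x : ('I_m -> nat) * ('I_n -> nat)) : A :=
  (\prod_l Q l ^+ x.1 l) * \prod_i 'X_i ^+ x.2 i.

Definition bounded_monomial d N (f : A) : Prop := exists a b,
  [/\ forall l, (a l <= d)%N, forall i, (b i <= N)%N & f = form_monomial (a, b)].

(** Above degree [N] a form is a combination of the [Q l] with cofactors of degree lower by [e];
    iterating leaves only cofactors of degree at most [N]. *)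
Lemma span_bounded_monomial N d f : (e <= N)%N -> full_at forms_ideal N ->
  f \is d.-homog -> lin_span (bounded_monomial d N) f.
Proof.
move=> leN full; elim/ltn_ind: d f => d IHd f hf.
have [led|ltd] := leqP d N.
  apply: homog_ind hf => [||c mu md]; [exact: lin_span0 | exact: lin_span_add |].
  rewrite -[X in lin_span _ X]addr0; apply: lin_spanD; last exact: lin_span0.
  exists (fun=> 0%N), mu; split=> // [i|].
    by apply: leq_trans led; rewrite -md mdegE (bigD1 i) //= leq_addr.
  by rewrite /form_monomial big1 // mul1r mpolyXE_id.
have [h [hh _ ->]] := full_at_leq forms_ideal_graded (ltnW ltd) full hf.
apply: big_ind => [||l _]; [exact: lin_span0 | exact: lin_span_add |].
have lt : (d - e < d)%N by rewrite ltn_subrL e_gt0; apply: leq_ltn_trans ltd.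
rewrite mulrC.
apply: (@lin_span_map _ _ (bounded_monomial (d - e) N) _ (fun g => Q l * g)); last exact: IHd.
  by move=> c g g'; rewrite mulrDr scalerAr.
move=> g [a [b [ha hb ->]]]; exists (fun i => (i == l) + a i)%N, b; split=> //.
  move=> i; apply: leq_trans (_ : 1 + (d - e) <= _)%N; last by rewrite add1n.
  by apply: leq_add; rewrite ?leq_b1.
rewrite /form_monomial mulrA; congr (_ * _) => /=.
under [RHS]eq_bigr do rewrite exprD.
rewrite big_split /=; congr (_ * _); rewrite (bigD1 l) //= eqxx big1 ?mulr1 //.
by move=> i /negPf->.
Qed.

Lemma monomials_free (U : finType) (mu : U -> 'X_{1.. n}) (c : 'I_#|U| -> k) :
  injective mu -> \sum_a c a *: ('X_[mu (enum_val a)] : A) = 0 ->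
  forall a, c a = 0.
Proof.
move=> inj sum0 a; have := congr1 (mcoeff (mu (enum_val a))) sum0.
rewrite mcoeff0 raddf_sum (bigD1 a) //= mcoeffZ mcoeffX eqxx mulr1 big1 ?addr0 //.
move=> b ba; rewrite mcoeffZ mcoeffX (inj_eq inj) (inj_eq enum_val_inj).
by rewrite (negPf ba) mulr0.
Qed.

(* A full graded piece would make A finitely generated over k[Q], but A has more
   monomials with exponents at most s than k[Q] can account for, s large. *)
Lemma forms_ideal_not_full N : (m < n)%N -> ~ full_at forms_ideal N.
Proof.
move=> ltmn; wlog leN : N / (e <= N)%N.
  move=> H full; apply: (H (maxn e N)); first exact: leq_maxl.
  by apply: full_at_leq full; [apply: forms_ideal_graded | apply: leq_maxr].
(* With this [s] one has [(D + 1)^m (N + 1)^n <= s (s + 1)^m < (s + 1)^n], so the spanning products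
   are fewer than the monomials with exponents at most [s]. *)
move=> full; pose s := (n ^ m * N.+1 ^ n)%N; pose D := (n * s)%N.
pose U : finType := {ffun 'I_n -> 'I_s.+1}.
pose T : finType := ({ffun 'I_m -> 'I_D.+1} * {ffun 'I_n -> 'I_N.+1})%type.
pose mu (u : U) : 'X_{1.. n} := [multinom (u i : nat) | i < n].
have mu_inj : injective mu.
  move=> u u' /mnmP h; apply/ffunP => i; apply: val_inj.
  by have := h i; rewrite !mnmE.
pose w (t : T) : A := form_monomial (fun l => t.1 l : nat, fun i => t.2 i : nat).
have [C CE] : exists C : U -> {ffun T -> k}, forall u,
    'X_[mu u] = \sum_t C u t *: w t.
  apply: (fin_all_exists (P := fun u (c : {ffun T -> k}) => 'X_[mu u] = \sum_t c t *: w t)) => u.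
  have hX : ('X_[mu u] : A) \is (mdeg (mu u)).-homog by rewrite dhomogX.
  have := span_bounded_monomial leN full hX; apply: lin_span_fin.
  move=> g [a [b [ha hb ->]]].
  have leD : (mdeg (mu u) <= D)%N.
    rewrite mdegE; apply: leq_trans (_ : \sum_(i < n) s <= _)%N.
      by apply: leq_sum => i _; rewrite mnmE -ltnS.
    by rewrite sum_nat_const card_ord.
  exists ([ffun l => inord (a l)], [ffun i => inord (b i)]).
  rewrite /w /form_monomial /=; congr (_ * _); apply: eq_bigr => i _;
    rewrite ffunE inordK // ltnS //.
  exact: leq_trans leD.
have [v v0 vM] : exists2 v : 'rV[k]_#|U|, v != 0 &
    v *m (\matrix_(a < #|U|, b < #|T|) C (enum_val a) (enum_val b)) = 0.
  apply: left_kernel_neq0; rewrite card_prod !card_ffun !card_ord.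
  have n0 : (0 < n)%N by apply: leq_ltn_trans ltmn.
  apply: leq_ltn_trans (_ : (n * s.+1) ^ m * N.+1 ^ n < _)%N.
    rewrite leq_mul2r; apply/orP; right; case: (posnP m) => [->|m0] //.
    by rewrite leq_exp2r // mulnS -add1n leq_add2r.
  rewrite expnMn mulnAC -/s; apply: leq_trans (_ : s.+1 ^ m.+1 <= _)%N.
    by rewrite expnS ltn_pmul2r ?expn_gt0.
  by rewrite leq_pexp2l.
case/eqP: v0; apply/rowP => a; rewrite mxE.
apply: (monomials_free mu_inj (c := fun a => v 0 a)).
under eq_bigr do rewrite CE scaler_sumr.
rewrite exchange_big big1 //= => t _.
under eq_bigr do rewrite scalerA.
rewrite -scaler_suml; move/rowP/(_ (enum_rank t)): vM; rewrite !mxE.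
under eq_bigr do rewrite mxE enum_rankK.
by move->; rewrite scale0r.
Qed.

Lemma common_zero : (m < n)%N ->
  exists2 v : 'rV[k]_n, v != 0 & forall l, peval (Q l) v = 0.
Proof.
move=> ltmn.
have [|v v0 vI] := graded_ideal_zero forms_ideal_graded.
  by move=> N; apply: forms_ideal_not_full.
exists v => // l; apply: (vI e); exists (fun i => (i == l)%:R).
split=> [i||]; first by rewrite subnn; case: eqP; rewrite ?dhomog1 ?dhomog0.
  by rewrite ltnn.
by rewrite (bigD1 l) //= eqxx mul1r big1 ?addr0 // => i /negPf->; rewrite mul0r.
Qed.

End CommonZero.

(** * Symmetric products of points *)

Section Points.
Variables (k : fieldType) (n : nat).
Implicit Types (p q : projSpace k n) (u v : 'rV[k]_n).

Lemma rep_neq0 p : rep p != 0. Proof. exact: (valP (repr p)). Qed.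

Lemma eqmx_rV u v : u != 0 -> (u <= v)%MS -> (u == v)%MS.
Proof.
move=> u0 uv; rewrite uv; have /sub_rVP[a uE] := uv.
have a0 : a != 0 by apply: contraNneq u0 => a0; rewrite uE a0 scale0r.
by rewrite uE (eqmx_scale _ a0) submx_refl.
Qed.

Lemma eqmx_scaleP u v : u != 0 -> (u == v)%MS -> exists2 a, a != 0 & u = a *: v.
Proof.
move=> u0 /andP[/sub_rVP[a uE] _]; exists a => //.
by apply: contraNneq u0 => a0; rewrite uE a0 scale0r.
Qed.

Lemma proj_eqP p q : (rep p == rep q)%MS -> p = q.
Proof. by move=> pq; rewrite -[p]reprK -[q]reprK; apply/eqquotP. Qed.

Lemma coords_of_inj u p q : coords_of u p -> coords_of u q -> p = q.
Proof.
rewrite /coords_of => /andP[up pu] /andP[uq qu]; apply: proj_eqP.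
by rewrite (submx_trans pu uq) (submx_trans qu up).
Qed.

Lemma coords_of_rep p : coords_of (rep p) p.
Proof. by rewrite /coords_of submx_refl. Qed.

Definition point u (u0 : u != 0) : projSpace k n :=
  (\pi_(projSpace k n) (exist _ u u0))%qT.

Lemma coords_of_point u (u0 : u != 0) : coords_of u (point u0).
Proof.
have /eqquotP : repr (point u0) = exist _ u u0 %[mod projSpace k n]%qT by rewrite reprK.
by rewrite /same_line /= /coords_of andbC.
Qed.

Lemma coords_of_neq0 u p : coords_of u p -> u != 0.
Proof.
apply: contraTneq => ->; apply/negP => /andP[_ /sub_rVP[a E]].
by have := rep_neq0 p; rewrite E scaler0 eqxx.
Qed.

Lemma coords_ofP u p : coords_of u p -> exists2 a, a != 0 & u = a *: rep p.
Proof. by move=> up; apply: eqmx_scaleP => //; apply: coords_of_neq0 up. Qed.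

Lemma coords_of_scale u p a : a != 0 -> coords_of u p -> coords_of (a *: u) p.
Proof. by move=> a0; rewrite /coords_of (eqmx_scale _ a0) // (eqmx_scale u a0). Qed.

End Points.

(** * Products of two linear forms *)

Section SymmetricProduct.
Variables (k : fieldType) (n : nat).
Implicit Types (p q r : 'rV[k]_n) (v : 'cV[k]_n).

Definition symprod p q : 'M[k]_n := p^T *m q + q^T *m p.

Lemma symprodE p q i j : symprod p q i j = p 0 i * q 0 j + q 0 i * p 0 j.
Proof. by rewrite !mxE !big_ord1 !mxE. Qed.

Lemma symprodC p q : symprod p q = symprod q p.
Proof. exact: addrC. Qed.

Lemma symprod_linear p a b q r :
  symprod p (a *: q + b *: r) = a *: symprod p q + b *: symprod p r.
Proof. by apply/matrixP => i j; rewrite /symprod !mxE !big_ord1 !mxE; ring. Qed.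

Lemma symprod_form p q v :
  (v^T *m symprod p q *m v) 0 0 = 2 * ((p *m v) 0 0 * (q *m v) 0 0).
Proof.
have tr r : (v^T *m r^T) = (r *m v)^T by rewrite trmx_mul.
rewrite /symprod mulmxDr mulmxDl !mulmxA !tr -!mulmxA.
by move: (p *m v) (q *m v) => a b; rewrite !mxE !big_ord1 !mxE; ring.
Qed.

Lemma annihilator_avoid p r : ~~ (p <= r)%MS -> exists v, r *m v = 0 /\ p *m v != 0.
Proof.
rewrite submxE => /rV0Pn[j nzj].
move: (cokermx r) (mulmx_coker r) nzj => C rC nzj; exists (col j C).
rewrite !colE !mulmxA rC mul0mx -colE; split=> //.
by apply: contraNneq nzj => /colP/(_ 0); rewrite !mxE => ->.
Qed.

Lemma annihilator_avoid2 p q r : ~~ (p <= r)%MS -> ~~ (q <= r)%MS ->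
  exists v, [/\ r *m v = 0, p *m v != 0 & q *m v != 0].
Proof.
move=> /annihilator_avoid[u [ru pu]] /annihilator_avoid[w [rw qw]].
have [qu|] := eqVneq (q *m u) 0; last by exists u.
have [pw|] := eqVneq (p *m w) 0; last by exists w.
by exists (u + w); rewrite !mulmxDr ru rw pw qu !addr0 add0r.
Qed.

Hypothesis two_neq0 : (2 : k) != 0.

(** Unique factorization: otherwise some zero of [p'] is a zero of neither [p] nor [q], and the two
    quadratic forms differ there. *)
Lemma symprod_factor p q p' q' a : symprod p q = a *: symprod p' q' ->
  (p <= p')%MS \/ (q <= p')%MS.
Proof.
move=> E; apply/orP; apply: contraT; rewrite negb_or => /andP[np nq].
have [v [p'v pv qv]] := annihilator_avoid2 np nq.
have := symprod_form p q v; rewrite E -scalemxAr -scalemxAl mxE symprod_form.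
rewrite p'v [X in _ * (_ * (X * _))]mxE mul0r !mulr0 => /esym/eqP.
rewrite !mulf_eq0 (negPf two_neq0) /=.
have nz r : r *m v != 0 -> (r *m v) 0 0 != 0.
  by apply: contraNneq => z; apply/eqP/matrixP => i j; rewrite !ord1 z mxE.
by rewrite (negPf (nz _ pv)) (negPf (nz _ qv)).
Qed.

Lemma symprod_eq0 p q : symprod p q = 0 -> p = 0 \/ q = 0.
Proof.
move=> E; have := @symprod_factor p q 0 0 0; rewrite E scale0r => /(_ erefl).
by case=> /sub_rVP[a ->]; rewrite scaler0; [left|right].
Qed.

Lemma mxdot_mxvec (M N : 'M[k]_n) : (mxvec M *m (mxvec N)^T) 0 0 = mxdot M N.
Proof.
rewrite mxE (reindex _ (curry_mxvec_bij n n)) /= /mxdot pair_bigA.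
by apply: eq_bigr => -[i j] _; rewrite mxE !mxvecE.
Qed.

Lemma mxdotDl (M M' N : 'M[k]_n) : mxdot (M + M') N = mxdot M N + mxdot M' N.
Proof. by rewrite !mxdotE mulmxDl linearD. Qed.

Lemma mxdotDr (M N N' : 'M[k]_n) : mxdot M (N + N') = mxdot M N + mxdot M N'.
Proof. by rewrite !mxdotE linearD mulmxDr linearD. Qed.

Lemma mxdot_sumr (M : 'M[k]_n) (J : finType) (c : J -> k) (N : J -> 'M[k]_n) :
  mxdot M (\sum_j c j *: N j) = \sum_j c j * mxdot M (N j).
Proof.
rewrite mxdotE linear_sum mulmx_sumr linear_sum; apply: eq_bigr => j _.
by rewrite linearZ /= -scalemxAr linearZ /= mxdotE.
Qed.

Lemma mxdot_tr (M N : 'M[k]_n) : mxdot M^T N^T = mxdot M N.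
Proof. by rewrite !mxdotE trmxK -mxtrace_tr trmx_mul trmxK mxtrace_mulC. Qed.

Lemma mxdotC (M N : 'M[k]_n) : mxdot M N = mxdot N M.
Proof. by apply: eq_bigr => i _; apply: eq_bigr => j _; rewrite mulrC. Qed.

Lemma mxdot_rank1 (M : 'M[k]_n) p q :
  mxdot M (p^T *m q) = \sum_i \sum_j M i j * (p 0 i * q 0 j).
Proof.
apply: eq_bigr => i _; apply: eq_bigr => j _; by rewrite !mxE big_ord1 mxE.
Qed.

Variable S : connGrAlg k.
Variables (x : 'I_n -> S) (G : 'I_n -> 'M[k]_n).
Hypothesis xG : quad_dual x G.
Hypothesis Gsym : forall m, (G m)^T = G m.

Definition annihilates p q : Prop := forall M, quad_relation x M ->
  \sum_i \sum_j M i j * (p 0 i * q 0 j) = 0.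

Lemma mxdot_symprod M p q : M^T = M ->
  mxdot M (symprod p q) = (\sum_i \sum_j M i j * (p 0 i * q 0 j)) *+ 2.
Proof.
move=> Ms; rewrite mxdotDr -!mxdot_rank1 mulr2n; congr (_ + _).
by rewrite -[LHS]mxdot_tr Ms trmx_mul trmxK.
Qed.

(** Biduality: membership in the span of [G] is tested against the columns of a cokernel, which are
    matrices orthogonal to [G]. *)
Lemma annihilatesP p q :
  annihilates p q <-> exists c : 'I_n -> k, symprod p q = \sum_m c m *: G m.
Proof.
split=> [pq|[c E] M /xG[Ms MG]]; last first.
  apply/eqP; rewrite -(mulrI_eq0 _ (lregP two_neq0)) mulr_natl -mxdot_symprod //.
  by rewrite E mxdot_sumr big1 // => m _; rewrite MG mulr0.
pose B := \matrix_m mxvec (G m).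
suff /submxP[c cE] : (mxvec (symprod p q) <= B)%MS.
  exists (c 0); apply: (can_inj mxvecK); rewrite cE linear_sum mulmx_sum_row.
  by apply: eq_bigr => m _; rewrite rowK linearZ.
rewrite submxE; move: (cokermx B) (mulmx_coker B) => C BC.
apply/eqP/rowP => j; rewrite [RHS]mxE; pose M := vec_mx (col j C)^T.
have dotM N : mxdot M N = (mxvec N *m C) 0 j.
  by rewrite mxdotC -mxdot_mxvec vec_mxK trmxK colE mulmxA -colE mxE.
have dotMt N : mxdot M^T N = mxdot M N^T by rewrite -[LHS]mxdot_tr trmxK.
have MG m : mxdot M (G m) = 0.
  have /matrixP/(_ m j) := BC; rewrite [RHS]mxE => <-.
  by rewrite dotM !mxE; apply: eq_bigr => i _; rewrite [in RHS]mxE.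
(* Pairing [M] with [symprod p q] is pairing [M + M^T] with [p^T *m q], and this symmetrization is a
   relation of [S]. *)
rewrite -dotM mxdotDr -[q^T *m p](trmxK) trmx_mul trmxK -dotMt -mxdotDl mxdot_rank1.
apply: pq; apply/xG; split=> [|m]; first by rewrite linearD /= trmxK addrC.
by rewrite mxdotDl dotMt Gsym MG addr0.
Qed.

End SymmetricProduct.

(** * Uniqueness of the partner of a point *)

Section Uniqueness.
Variables (k : closedFieldType) (n : nat).
Hypothesis two_neq0 : (2 : k) != 0.
Implicit Types (p q r v : 'rV[k]_n).

Definition quad_form (M : 'M[k]_n) v : k := \sum_i \sum_j v 0 i * v 0 j * M i j.

Lemma quad_formE M v : quad_form M v = (v *m M *m v^T) 0 0.
Proof.
rewrite mxE /quad_form exchange_big; apply: eq_bigr => j _; rewrite !mxE mulr_suml.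
by apply: eq_bigr => i _; rewrite mulrAC.
Qed.

Lemma quad_form_sum (J : finType) (c : J -> k) (M : J -> 'M[k]_n) v :
  quad_form (\sum_j c j *: M j) v = \sum_j c j * quad_form (M j) v.
Proof.
rewrite quad_formE mulmx_sumr mulmx_suml summxE; apply: eq_bigr => j _.
by rewrite -scalemxAr -scalemxAl mxE quad_formE.
Qed.

Lemma quad_form_symprod p q v :
  quad_form (symprod p q) v = 2 * ((p *m v^T) 0 0 * (q *m v^T) 0 0).
Proof. by rewrite quad_formE -symprod_form trmxK. Qed.

Definition quad_poly (M : 'M[k]_n) : mpoly n k :=
  \sum_i \sum_j M i j *: ('X_i * 'X_j).

Lemma quad_poly_homog M : quad_poly M \is 2.-homog.
Proof.
apply: rpred_sum => i _; apply: rpred_sum => j _; apply: dhomogZ.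
by rewrite (@dhomogM _ _ _ 1 _ 1) // dhomogX /= mdeg1.
Qed.

Lemma peval_quad_poly M v : peval (quad_poly M) v = quad_form M v.
Proof.
rewrite /peval /quad_poly raddf_sum; apply: eq_bigr => i _.
rewrite raddf_sum; apply: eq_bigr => j _ /=.
by rewrite mevalZ mevalM !mevalXU mulrC.
Qed.

Variable G : 'I_n -> 'M[k]_n.
Hypothesis bpf : forall v, v != 0 -> exists l, quad_form (G l) v != 0.

(* Two independent elements of the span of G divisible by the linear form p would
   leave n - 2 quadrics and p, hence a common zero of all of G. *)
Lemma symprod_span_unique p q r (c d : 'I_n -> k) : p != 0 -> q != 0 -> r != 0 ->
  symprod p q = \sum_m c m *: G m -> symprod p r = \sum_m d m *: G m ->
  (q <= r)%MS.
Proof.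
move=> p0 q0 r0 pq pr; pose C : 'M[k]_(2, n) := \matrix_(i, m) if i == 0 then c m else d m.
have C0 m : C 0 m = c m by rewrite mxE.
have C1 m : C 1 m = d m by rewrite mxE.
(* If [c] and [d] are dependent, a nontrivial combination of [q] and [r] has zero product with [p],
   so it vanishes. The independent case leads to a contradiction. *)
have [freeC|] := boolP (row_free C); last first.
  rewrite -kermx_eq0 => /rowV0Pn[u /sub_kermxP uC u0].
  have : symprod p (u 0 0 *: q + u 0 1 *: r) = 0.
    rewrite symprod_linear pq pr !scaler_sumr -big_split big1 //= => m _.
    rewrite !scalerA -scalerDl -[X in X *: _](_ : (u *m C) 0 m = _); last first.
      by rewrite mxE big_ord_recl big_ord1 C0 -C1; congr (_ + u 0 _ * C _ _); apply: val_inj.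
    by rewrite uC mxE scale0r.
  case/(symprod_eq0 two_neq0) => [/eqP|]; first by rewrite (negPf p0).
  have [u00|u00] := eqVneq (u 0 0) 0.
    rewrite u00 scale0r add0r => /eqP; rewrite scaler_eq0 (negPf r0) orbF => /eqP u01.
    case/eqP: u0; apply/rowP => i; rewrite mxE.
    case: i => [[|[|//]] ?]; first by rewrite -[RHS]u00; congr (u 0 _); apply: val_inj.
    by rewrite -[RHS]u01; congr (u 0 _); apply: val_inj.
  move/eqP; rewrite addr_eq0 => /eqP E; apply/sub_rVP; exists (- (u 0 1 / u 0 0)).
  apply: (scalerI u00); rewrite E scalerA mulrN mulrCA mulfV // mulr1.
  by rewrite scaleNr.
have rC : \rank C = 2 by apply/eqP.
have le2n : (2 <= n)%N by have := rank_leq_col C; rewrite rC.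
(* The rows of [D] complement [c] and [d], giving [n - 2] quadrics; the square of [p] makes [n - 1]
   in [n] variables. *)
pose D := row_base (C^C)%MS.
pose Q (l : 'I_(\rank (C^C)%MS).+1) := if unlift ord0 l is Some l' then
  \sum_m D l' m *: quad_poly (G m) else quad_poly (p^T *m p).
have hQ l : Q l \is 2.-homog.
  rewrite /Q; case: unliftP => [l' _|_]; last exact: quad_poly_homog.
  by apply: rpred_sum => m _; apply: dhomogZ; apply: quad_poly_homog.
have [||v v0 vQ] := @common_zero k n _ 2 Q _ hQ => //.
  by rewrite mxrank_compl rC -subSn // subSS ltn_subrL (leq_trans _ le2n).
have pv : (p *m v^T) 0 0 = 0.
  have := vQ ord0; rewrite /Q unlift_none peval_quad_poly quad_formE.
  rewrite mulmxA -mulmxA mxE big_ord1 -[v *m p^T]trmxK trmx_mul trmxK [_^T 0 0]mxE.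
  by move/eqP; rewrite mulf_eq0 orbb => /eqP.
(* The values of all [G m] at [v]: [C] kills them because both products contain the factor [p], and
   [D] does by the choice of [v]. *)
pose g : 'cV[k]_n := \col_m quad_form (G m) v.
have Cg : C *m g = 0.
  apply/matrixP => i j; rewrite ord1 [RHS]mxE mxE.
  transitivity (quad_form (\sum_m C i m *: G m) v).
    by rewrite quad_form_sum; apply: eq_bigr => m _; rewrite [g _ _]mxE.
  have [->|i0] := eqVneq i 0.
    under eq_bigr do rewrite C0.
    by rewrite -pq quad_form_symprod pv mul0r mulr0.
  have -> : i = 1 by case: i i0 => [[|[|//]] ?] // _; apply: val_inj.
  under eq_bigr do rewrite C1.
  by rewrite -pr quad_form_symprod pv mul0r mulr0.
have Dg : D *m g = 0.
  apply/matrixP => i j; rewrite ord1 [RHS]mxE mxE -[RHS](vQ (lift ord0 i)) /Q liftK.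
  rewrite /peval raddf_sum /=; apply: eq_bigr => m _.
  by rewrite mevalZ -/(peval _ v) peval_quad_poly [g _ _]mxE.
have g0 : g = 0.
  have : (1%:M <= kermx g)%MS.
    apply: submx_trans (_ : (C + C^C <= _)%MS); first by rewrite sub1mx addsmx_compl_full.
    rewrite addsmx_sub; apply/andP; split; first exact/sub_kermxP.
    by rewrite -(eq_row_base (C^C)%MS); apply/sub_kermxP.
  by move/sub_kermxP; rewrite mul1mx.
have [l] := bpf v0; case/eqP.
by move/colP/(_ l): g0; rewrite !mxE.
Qed.

End Uniqueness.

(** * The zero locus and its automorphism *)

Section LinearForms.
Variables (k : fieldType) (n : nat).
Local Notation A := (mpoly n k).

(** The predicate need not be decidable, so [K] is enlarged classically while some vector of [P] is
    missing; [j] bounds the codimension left. *)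
Lemma subspace_span d (P : 'rV[k]_d -> Prop) :
  P 0 -> (forall a u v, P u -> P v -> P (a *: u + v)) ->
  exists K : 'M[k]_d, forall v, P v <-> (v <= K)%MS.
Proof.
move=> P0 PD.
suff H j (K : 'M[k]_d) : (forall u, (u <= K)%MS -> P u) -> (d - \rank K <= j)%N ->
    exists K' : 'M[k]_d, forall v, P v <-> (v <= K')%MS.
  apply: (H d 0); last exact: leq_subr.
  by move=> u /submxP[D ->]; rewrite mulmx0.
elim: j K => [|j IHj] K PK leK.
  exists K => v; split=> [_|/PK//]; apply: submx_full.
  by rewrite /row_full eqn_leq rank_leq_col -subn_eq0 -leqn0.
have [full|nfull] := classic (forall v, P v -> (v <= K)%MS).
  by exists K => v; split=> [/full|/PK].
have [v [Pv nv]] : exists v, P v /\ ~~ (v <= K)%MS.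
  apply: NNPP => nex; apply: nfull => v Pv; apply: contraT => nv.
  by case: nex; exists v.
apply: (IHj (K + v)%MS) => [u|].
  case/sub_addsmxP => -[u1 u2] /= ->; rewrite addrC.
  have /sub_rVP[b ->] : (u2 *m v <= v)%MS by apply: submxMl.
  by apply: PD => //; apply: PK; apply: submxMl.
have lt : (\rank K < \rank (K + v)%MS)%N.
  rewrite rank_ltmx // ltmxE addsmxSl /=.
  by apply: contra nv => h; apply: submx_trans h; apply: addsmxSr.
rewrite leq_subLR; move: leK; rewrite leq_subLR addnS => le.
by apply: leq_trans le _; rewrite -addSn leq_add2r.
Qed.

Lemma homog_prod d (f : 'I_d -> A) : (forall i, f i \is 1.-homog) ->
  \prod_i f i \is d.-homog.
Proof.
elim: d f => [|d IHd] f hf; first by rewrite big_ord0 dhomog1.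
by rewrite big_ord_recl; apply: (dhomogM (hf _)); apply: IHd => i; apply: hf.
Qed.

Lemma homog_det d (M : 'M[A]_d) : (forall i j, M i j \is 1.-homog) ->
  \det M \is d.-homog.
Proof.
move=> hM; apply: rpred_sum => s _; rewrite -signr_odd.
have hp : \prod_i M i (perm.fun_of_perm s i) \is d.-homog by apply: homog_prod.
by case: odd; rewrite ?expr1 ?expr0 ?mul1r ?mulN1r ?dhomogN.
Qed.

(** Row [i] is exempt because it is deleted; in the application it is made of constants. *)
Lemma homog_cofactor d (M : 'M[A]_d) i j :
  (forall i' j', i' != i -> M i' j' \is 1.-homog) -> cofactor M i j \is d.-1.-homog.
Proof.
move=> hM; rewrite /cofactor -signr_odd.
have hd : \det (row' i (col' j M)) \is d.-1.-homog.
  by apply: homog_det => i' j'; rewrite !mxE hM // eq_sym neq_lift.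
by case: odd; rewrite ?expr1 ?expr0 ?mul1r ?mulN1r ?dhomogN.
Qed.

Lemma peval_det d (M : 'M[A]_d) (v : 'rV[k]_n) :
  peval (\det M) v = \det (map_mx (fun f => peval f v) M).
Proof. by rewrite /peval -det_map_mx. Qed.

Lemma peval_adj d (M : 'M[A]_d) (v : 'rV[k]_n) i j :
  peval ((\adj M) i j) v = (\adj (map_mx (fun f => peval f v) M)) i j.
Proof.
have -> : map_mx (fun f => peval f v) M = map_mx (meval (fun i => v 0 i)) M by [].
by rewrite -map_mx_adj [RHS]mxE.
Qed.

End LinearForms.

Section ZeroLocus.
Variables (k : closedFieldType) (n : nat) (S : connGrAlg k) (x : 'I_n -> S).
Implicit Types (p q : projSpace k n) (u v : 'rV[k]_n).

Lemma annihilatesE u v : annihilates x u v <->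
  forall M, quad_relation x M -> u *m M *m v^T = 0.
Proof.
have E M : u *m M *m v^T = (\sum_i \sum_j M i j * (u 0 i * v 0 j))%:M.
  apply/matrixP => a b; rewrite !ord1 !mxE eqxx mulr1n exchange_big.
  apply: eq_bigr => j _; rewrite !mxE mulr_suml; apply: eq_bigr => i _.
  by rewrite mulrAC mulrC.
split=> h M /h; first by rewrite E => ->; rewrite raddf0.
by rewrite E => /matrixP/(_ 0 0); rewrite !mxE eqxx mulr1n.
Qed.

Lemma annihilates_coords u v p q : coords_of u p -> coords_of v q ->
  (rel_zero_locus x p q <-> annihilates x u v).
Proof.
move=> /coords_ofP[a a0 ->] /coords_ofP[b b0 ->].
split=> [/annihilatesE h|/annihilatesE h]; apply/annihilatesE => M /h.
  by rewrite linearZ /= -!scalemxAl -!scalemxAr => ->; rewrite !scaler0.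
rewrite linearZ /= -!scalemxAl -!scalemxAr scalerA => /eqP.
by rewrite scaler_eq0 mulf_eq0 (negPf a0) (negPf b0) => /eqP.
Qed.

Lemma quad_relation_span : exists (r : nat) (T : 'I_r -> 'M[k]_n), forall u v,
  annihilates x u v <-> forall l, u *m T l *m v^T = 0.
Proof.
have [|a u v|K KP] := @subspace_span k _ (fun w => quad_relation x (vec_mx w)).
- by rewrite /quad_relation big1 // => i _; rewrite big1 // => j _; rewrite linear0 mxE scale0r.
- rewrite /quad_relation linearP /= => Hu Hv.
  transitivity (a *: (\sum_i \sum_j vec_mx u i j *: (x i * x j))
     + \sum_i \sum_j vec_mx v i j *: (x i * x j)); last by rewrite Hu Hv scaler0 addr0.
  rewrite scaler_sumr -big_split; apply: eq_bigr => i _ /=.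
  rewrite scaler_sumr -big_split; apply: eq_bigr => j _ /=.
  by rewrite 2!mxE scalerDl scalerA.
exists (n * n)%N, (fun l => vec_mx (row l K)) => u v.
split=> [/annihilatesE h l|h]; first by apply: h; apply/KP; apply: row_sub.
apply/annihilatesE => M; rewrite -[M]mxvecK => /KP/submxP[c ->].
rewrite (mulmx_sum_row c) linear_sum mulmx_sumr mulmx_suml big1 // => l _.
by rewrite linearZ /= -scalemxAr -scalemxAl h scaler0.
Qed.

Definition locus p : Prop := exists q, rel_zero_locus x p q.

Definition partner p : projSpace k n := epsilon (inhabits p) (rel_zero_locus x p).

Lemma partnerP p : locus p -> rel_zero_locus x p (partner p).
Proof. exact: epsilon_spec. Qed.

Section Presentation.
Variables (r : nat) (T : 'I_r -> 'M[k]_n).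
Hypothesis TP : forall u v, annihilates x u v <-> forall l, u *m T l *m v^T = 0.

(** The linear equations for the partners of [u]; [rel_poly] has the same entries as linear forms in
    the coordinates of [u]. *)
Definition rel_mx u : 'M[k]_(r, n) := \matrix_(l, j) (u *m T l) 0 j.

Definition rel_poly : 'M[mpoly n k]_(r, n) :=
  \matrix_(l, j) \sum_i T l i j *: 'X_i.

Lemma rel_mxP u v : annihilates x u v <-> rel_mx u *m v^T = 0.
Proof.
have rowE l : row l (rel_mx u) = u *m T l by apply/rowP => j; rewrite !mxE.
rewrite TP; split=> [h|h l]; last by rewrite -rowE -row_mul h row0.
by apply/row_matrixP => l; rewrite row_mul rowE h row0.
Qed.

Lemma rel_poly_homog l j : rel_poly l j \is 1.-homog.
Proof.
rewrite mxE; apply: rpred_sum => i _; apply: dhomogZ.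
by rewrite dhomogX /= mdeg1.
Qed.

Lemma rel_polyE u : map_mx (fun f => peval f u) rel_poly = rel_mx u.
Proof.
apply/matrixP => l j; rewrite !mxE /peval raddf_sum; apply: eq_bigr => i _ /=.
by rewrite mevalZ mevalXU mulrC.
Qed.

Lemma not_row_full_kernel m (M : 'M[k]_(m, n)) : ~~ row_full M ->
  exists2 v : 'rV[k]_n, v != 0 & M *m v^T = 0.
Proof.
rewrite -cokermx_eq0; move: (cokermx M) (mulmx_coker M) => C MC nz.
have [j nzj] : exists j, col j C != 0.
  have /matrix0Pn[i [j nzij]] := nz; exists j.
  by apply: contraNneq nzij => /colP/(_ i); rewrite !mxE => ->.
exists (col j C)^T; rewrite ?trmxK; last by rewrite colE mulmxA MC mul0mx.
by apply: contraNneq nzj => z; rewrite -[col j C]trmxK z trmx0.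
Qed.

Lemma row_full_kernel m (M : 'M[k]_(m, n)) (v : 'rV[k]_n) :
  row_full M -> M *m v^T = 0 -> v = 0.
Proof.
move=> /row_fullP[B BM] Mv; apply: trmx_inj.
by rewrite trmx0 -[LHS]mul1mx -BM -mulmxA Mv mulmx0.
Qed.

Lemma locusP p : locus p <-> ~~ row_full (rel_mx (rep p)).
Proof.
split=> [[q /rel_mxP h]|/not_row_full_kernel[v v0 h]].
  by apply: contraL (rep_neq0 q) => /row_full_kernel/(_ h) ->; rewrite negbK.
exists (point v0); apply/(annihilates_coords (coords_of_rep p) (coords_of_point v0)).
exact/rel_mxP.
Qed.

(** A partner exists exactly where the equations have rank below [n], that is, where all minors of
    size [n] vanish; a [g] with repeated values only adds a zero minor. *)
Lemma locus_closed : closed_subset locus.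
Proof.
exists (fun f => exists g : 'I_n -> 'I_r, f = \det (rowsub g rel_poly)); split.
  move=> _ [g ->]; exists n; apply: homog_det => i j; rewrite mxE; exact: rel_poly_homog.
have E g u : peval (\det (rowsub g rel_poly)) u = \det (rowsub g (rel_mx u)).
  by rewrite peval_det map_mxsub rel_polyE.
move=> p; split=> [/locusP nf f [g ->]|h].
  rewrite E; apply/eqP; apply: contraT => nz; case/negP: nf.
  rewrite /row_full eqn_leq rank_leq_col.
  have /mxrank_unit {1}<- : rowsub g (rel_mx (rep p)) \in unitmx by rewrite unitmxE unitfE.
  by rewrite mxrankS // rowsub_sub.
apply/locusP/negP => full.
have /eqP : peval (\det (rowsub (fullrankfun full) rel_poly)) (rep p) = 0.
  by apply: h; exists (fullrankfun full).
rewrite E; apply/negP; rewrite -unitfE -unitmxE; exact: fullrowsub_unit.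
Qed.

Hypothesis unique : forall p q q',
  rel_zero_locus x p q -> rel_zero_locus x p q' -> q = q'.

(* Complete the rows of rel_mx p by a coordinate row a not orthogonal to the
   partner q, select n rows of rank n, and read q off the column of the adjugate
   attached to a; where the determinant is nonzero the same formula gives q. *)
Lemma partner_morphism : morphism_on locus partner.
Proof.
move=> p pE; have pq := partnerP pE; set q := partner p in pq.
have /rV0Pn[j0 qj0] := rep_neq0 q.
pose a : 'rV[k]_n := delta_mx 0 j0.
have aE (v : 'rV[k]_n) : a *m v^T = (v 0 j0)%:M.
  by rewrite -rowE; apply/matrixP => i j; rewrite !ord1 !mxE eqxx mulr1n.
have full : row_full (col_mx a (rel_mx (rep p))).
  apply: contraT => /not_row_full_kernel[v v0].
  rewrite mul_col_mx => /eqP.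
  rewrite col_mx_eq0 => /andP[/eqP av /eqP Nv].
  have pv : rel_zero_locus x p (point v0).
    by apply/(annihilates_coords (coords_of_rep p) (coords_of_point v0))/rel_mxP.
  have /coords_ofP[b b0 vE] := coords_of_point v0.
  rewrite -(unique pq pv) in vE; move: av; rewrite aE vE => /matrixP/(_ 0 0).
  by rewrite !mxE eqxx mulr1n => /eqP; rewrite mulf_eq0 (negPf b0) (negPf qj0).
pose f := fullrankfun full; pose M u := rowsub f (col_mx a (rel_mx u)).
have MU : M (rep p) \in unitmx by apply: fullrowsub_unit.
have ME u (v : 'rV[k]_n) i : rel_mx u *m v^T = 0 ->
    (M u *m v^T) i 0 = if f i == lshift r 0 then v 0 j0 else 0.
  move=> Nv; rewrite /M mul_rowsub_mx mul_col_mx Nv aE mxE.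
  case: (split_ordP (f i)) => l ->; first by rewrite col_mxEu !ord1 eqxx mxE eqxx.
  by rewrite col_mxEd mxE eq_rlshift.
(* The row [a] must be among the selected ones, since every other row kills the nonzero vector of
   [q]. *)
have [i0 fi0] : exists i : 'I_n, f i = lshift r 0.
  apply: NNPP => nex; case/eqP: (rep_neq0 q).
  apply: (@row_full_kernel _ (M (rep p))); first by rewrite row_full_unit.
  apply/colP => i; rewrite ME; last exact/rel_mxP.
  by rewrite mxE; case: eqP => // fi; case: nex; exists i.
have fE (i : 'I_n) : (f i == lshift r 0) = (i == i0).
  by rewrite -fi0 (inj_eq (@fullrankfun_inj _ _ _ _ full)).
pose MP : 'M[mpoly n k]_n := rowsub f (col_mx (map_mx (@mpolyC n k) a) rel_poly).
have MPE u : map_mx (fun g => peval g u) MP = M u.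
  rewrite map_mxsub map_col_mx rel_polyE -map_mx_comp; congr (rowsub _ (col_mx _ _)).
  by apply/matrixP => i j; rewrite !mxE /= /peval mevalC.
have MP1 i j : i != i0 -> MP i j \is 1.-homog.
  rewrite -fE mxE; case: (split_ordP (f i)) => l ->; first by rewrite ord1 eqxx.
  by rewrite col_mxEd => _; apply: rel_poly_homog.
(* Row [i0] is constant, so the cofactors along it have degree [n.-1], and so has the
   determinant. *)
have hc j : cofactor MP i0 j \is n.-1.-homog by apply: homog_cofactor => *; apply: MP1.
exists (fun u : projSpace k n => peval (\det MP) (rep u) != 0), n.-1, (fun j => cofactor MP i0 j); split=> //.
- exists (fun g => g = \det MP); split.
    move=> _ ->; exists n.-1; rewrite (expand_det_row _ i0); apply: rpred_sum => j _.
    by rewrite [MP i0 j]mxE fi0 col_mxEu mxE mul_mpolyC dhomogZ.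
  by move=> u; split=> [/negP/negPn/eqP h _ ->//|/(_ _ erefl) ->]; apply/negP; rewrite eqxx.
- by rewrite peval_det MPE -unitfE -unitmxE.
move=> u uE; rewrite peval_det MPE => det0; have uz := partnerP uE.
set z := partner u in uz *; set w := \row_i _.
(* Cramer's rule: [M (rep u)] sends [z] to a multiple of the basis vector at [i0], so column [i0] of
   the adjugate is proportional to [z]. *)
have wE : rep z 0 j0 *: w^T = \det (M (rep u)) *: (rep z)^T.
  rewrite -[RHS]mul_scalar_mx -mul_adj_mx -mulmxA.
  have -> : M (rep u) *m (rep z)^T = rep z 0 j0 *: delta_mx i0 0.
    apply/colP => i; rewrite ME; last exact/rel_mxP.
    by rewrite fE !mxE eqxx andbT; case: eqP; rewrite ?mulr1 ?mulr0.
  rewrite -scalemxAr; congr (_ *: _); rewrite -colE; apply/colP => i.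
  rewrite [LHS]mxE mxE [RHS]mxE -(MPE (rep u)) -peval_adj; congr (peval _ _).
  by rewrite [RHS]mxE.
have z0 : rep z 0 j0 != 0.
  apply: contraTneq det0 => z0; rewrite negbK; move/eqP: wE.
  by rewrite z0 scale0r eq_sym scaler_eq0 trmx_eq0 (negPf (rep_neq0 z)) orbF.
have -> : w = (\det (M (rep u)) / rep z 0 j0) *: rep z.
  apply: trmx_inj; apply: (scalerI z0); rewrite wE linearZ /= scalerA.
  by rewrite mulrCA mulfV // mulr1.
apply: coords_of_scale (coords_of_rep z).
by rewrite mulf_neq0 // invr_eq0.
Qed.

End Presentation.
End ZeroLocus.

(** Commutativity of [symprod] makes the zero locus symmetric, so [partner] is an involution and its
    own inverse morphism. *)
Lemma G1_quad_dual (k : closedFieldType) (n : nat) (S : connGrAlg k)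
    (x : 'I_n -> S) (G : 'I_n -> 'M[k]_n) :
  (2 : k) != 0 -> quad_dual x G -> (forall m, (G m)^T = G m) ->
  (forall v : 'rV[k]_n, v != 0 -> exists l, quad_form (G l) v != 0) ->
  exists (E : projSpace k n -> Prop) (sigma : projSpace k n -> projSpace k n),
    G1_with x E sigma /\ forall p, E p -> sigma (sigma p) = p.
Proof.
move=> two xG Gsym bpf.
have [r [T TP]] := quad_relation_span x.
have sym p q : rel_zero_locus x p q -> rel_zero_locus x q p.
  move/(annihilatesP two xG Gsym) => [c E]; apply/(annihilatesP two xG Gsym).
  by exists c; rewrite symprodC.
have uniq p q q' : rel_zero_locus x p q -> rel_zero_locus x p q' -> q = q'.
  move=> /(annihilatesP two xG Gsym)[c E] /(annihilatesP two xG Gsym)[d E'].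
  apply: proj_eqP; apply: eqmx_rV; first exact: rep_neq0.
  by apply: (symprod_span_unique two bpf _ _ _ E E'); apply: rep_neq0.
have sK p : locus x p -> locus x (partner x p) /\ partner x (partner x p) = p.
  move=> pE; have /sym qp := partnerP pE; have qE : locus x (partner x p) by exists p.
  by split=> //; apply: uniq (partnerP qE) qp.
have mor := partner_morphism TP uniq.
exists (locus x), (partner x); split; last by move=> p /sK[].
split; first exact: locus_closed TP.
- by exists (partner x); split=> // p /sK[].
- move=> p q; split=> [pq|[pE ->]]; last exact: partnerP.
  have pE : locus x p by exists q.
  by split=> //; apply: uniq pq (partnerP pE).
Qed.

(** * The double cover *)

Section RankTwo.
Variables (k : closedFieldType) (n : nat).
Implicit Types (A : 'M[k]_n).

(** A step of Lagrange reduction: column [i] of [A'] vanishes, so its row space, contained in that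
    of [A], misses row [i] of [A]. *)
Lemma sym_peel A i : A^T = A -> A i i != 0 ->
  let A' := A - (A i i)^-1 *: ((row i A)^T *m row i A) in
  A'^T = A' /\ (\rank A' < \rank A)%N.
Proof.
move=> As nz A'; split.
  by rewrite linearB /= linearZ /= trmx_mul trmxK As.
have A'i j : A' j i = 0.
  by rewrite !mxE big_ord1 !mxE -[in A i j]As mxE mulrCA mulVf // mulr1 subrr.
apply: rank_ltmx; rewrite ltmxE; apply/andP; split.
  rewrite addmx_sub ?submx_refl // eqmx_opp scalemx_sub //.
  by apply: submx_trans (submxMl _ _) (row_sub _ _).
apply: contra nz => AA'; have /submxP[D DE] : (row i A <= A')%MS.
  exact: submx_trans (row_sub _ _) AA'.
have : (row i A) 0 i = 0 by rewrite DE mxE big1 // => j _; rewrite A'i mulr0.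
by rewrite mxE => ->.
Qed.

(** The 2 by 2 minors vanish, so the square of [A i j] is [A i i * A j j], and a zero diagonal would
    force [A = 0]. *)
Lemma sym_rank1_diag A : A^T = A -> (\rank A < 2)%N -> A != 0 ->
  exists i, A i i != 0.
Proof.
move=> As rA A0; apply: NNPP => nex.
have diag i : A i i = 0.
  by apply/eqP; apply: contraT => nz; case: nex; exists i.
have minor i j : A i j * A j i = A i i * A j j.
  move: rA (mulmx_base A); move: (\rank A) (col_base A) (row_base A).
  case=> [|[|//]] C R _ <-; rewrite !mxE ?big_ord0 ?mulr0 // !big_ord1.
  by rewrite mulrACA [R 0 j * _]mulrC mulrACA.
case/eqP: A0; apply/matrixP => i j; rewrite mxE.
have := minor i j; rewrite !diag mulr0 -[in A j i]As mxE => /eqP.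
by rewrite mulf_eq0 orbb => /eqP.
Qed.

Lemma sqrt_exists (c : k) : exists s : k, s ^+ 2 = c.
Proof.
have [|s] := @closed_rootP k ('X^2 - c%:P) _; first by rewrite size_XnsubC.
by rewrite rootE !hornerE subr_eq0 => /eqP; exists s.
Qed.

(** Peeling off two squares leaves [al a^2 + be b^2], which factors as a difference of squares. *)
Lemma rank2_symprod A i : (2 : k) != 0 -> A^T = A -> A i i != 0 ->
  (\rank A < 3)%N -> exists p q, A = symprod p q.
Proof.
move=> two As nz rA; have [] := sym_peel As nz.
set a := row i A; set A' := _ - _ => A's rA'; set al := (A i i)^-1 in A' A's rA'.
have AE : A = al *: (a^T *m a) + A' by rewrite addrC subrK.
have [be [b A'E]] : exists be (b : 'rV_n), A' = be *: (b^T *m b).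
  have [->|A'0] := eqVneq A' 0; first by exists 0, 0; rewrite scale0r.
  have rA'2 : (\rank A' < 2)%N by rewrite -ltnS (leq_trans _ rA) // ltnS.
  have [j nzj] := sym_rank1_diag A's rA'2 A'0.
  have [_ rA''] := sym_peel A's nzj; exists (A' j j)^-1, (row j A').
  apply/eqP; rewrite -subr_eq0 -mxrank_eq0 -leqn0 -ltnS.
  by apply: leq_trans rA'' _; rewrite -ltnS.
have al0 : al != 0 by rewrite invr_eq0.
have [s sE] := sqrt_exists (- (be / al)).
(* The half compensates for [symprod], which doubles the product of the two linear forms. *)
exists ((al / 2) *: (a - s *: b)), (a + s *: b).
have beE : be = - al * s ^+ 2 by rewrite sE mulrNN mulrC divfK.
rewrite AE A'E beE; apply/matrixP => u v; rewrite symprodE !mxE !big_ord1 !mxE.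
by field.
Qed.

End RankTwo.

Section DoubleCover.
Variables (k : closedFieldType) (n : nat) (S : connGrAlg k) (x : 'I_n -> S).
Variable F : n.-tuple 'M[k]_n.
Local Notation Fm m := (tnth F m).
Hypothesis two_neq0 : (2 : k) != 0.
Hypothesis Fsym : forall m, (Fm m)^T = Fm m.
Hypothesis Fnorm : normalized F.
Hypothesis xF : quad_dual x (fun m => Fm m).
Implicit Types (p q : projSpace k n) (u v : 'rV[k]_n).

Lemma normalized_diag (c : 'I_n -> k) i : (\sum_m c m *: Fm m) i i = c i *+ 2.
Proof.
rewrite summxE (bigD1 i) //= mxE Fnorm eqxx big1 ?addr0 => [|m /negPf mi].
  by rewrite mulr_natr.
by rewrite mxE Fnorm mi mulr0.
Qed.

(** By normalization the diagonal of the right side is twice [c], and that of [symprod u v] is twice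
    the coordinatewise product. *)
Lemma symprod_diag u v (c : 'I_n -> k) i :
  symprod u v = \sum_m c m *: Fm m -> u 0 i * v 0 i = c i.
Proof.
move/matrixP/(_ i i); rewrite normalized_diag symprodE [v 0 i * _]mulrC -mulr2n.
by rewrite -[_ * _ *+ 2]mulr_natl -[c i *+ 2]mulr_natl => /(mulfI two_neq0).
Qed.

Lemma annihilates_hadamard u v : annihilates x u v ->
  symprod u v = \sum_m hadamard u v 0 m *: Fm m.
Proof.
move/(annihilatesP two_neq0 xF Fsym) => [c E]; rewrite E; apply: eq_bigr => m _.
by rewrite mxE (symprod_diag _ E).
Qed.

Lemma hadamard_scale a b u v :
  hadamard (a *: u) (b *: v) = (a * b) *: hadamard u v.
Proof. by apply/rowP => i; rewrite !mxE mulrACA. Qed.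

Variables (E : projSpace k n -> Prop) (sigma : projSpace k n -> projSpace k n).
Hypothesis G1 : G1_with x E sigma.

Let relE p q : rel_zero_locus x p q <-> E p /\ q = sigma p.
Proof. by case: G1. Qed.

Let pairing p := hadamard (rep p) (rep (sigma p)).

Let pairingE p : E p -> symprod (rep p) (rep (sigma p)) = \sum_m pairing p 0 m *: Fm m.
Proof. by move=> pE; apply: annihilates_hadamard; apply/relE. Qed.

(** The vector [pairing p] defines a point only where it is nonzero, which [coverP] proves on [E];
    hence the choice operator. *)
Definition cover p : projSpace k n := epsilon (inhabits p) (coords_of (pairing p)).

Lemma coverP p : E p -> coords_of (pairing p) (cover p).
Proof.
move=> pE; apply: (epsilon_spec (inhabits p) (fun l => coords_of (pairing p) l)).
have nz : pairing p != 0.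
  apply: contraTneq (rep_neq0 p) => z; have := pairingE pE.
  rewrite z big1 => [|m _]; last by rewrite mxE scale0r.
  case/(symprod_eq0 two_neq0) => [->|/eqP]; first by rewrite eqxx.
  by rewrite (negPf (rep_neq0 _)).
by exists (point nz); apply: coords_of_point.
Qed.

Lemma cover_morphism : morphism_on E cover.
Proof.
case: G1 => _ [t [_ _ mor _]] _ p /mor[U [e [g [cU Up hg gE]]]].
exists U, e.+1, (fun i => 'X_i * g i); split=> // [i|q qE Uq].
  by apply: (dhomogM (d := 1) (e := e)); rewrite // dhomogX /= mdeg1.
have [a a0 aE] := coords_ofP (gE q qE Uq).
suff -> : \row_i peval ('X_i * g i) (rep q) = a *: pairing q.
  exact: coords_of_scale a0 (coverP qE).
apply/rowP => i; rewrite !mxE /peval mevalM mevalXU mulrCA; congr (_ * _).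
by move/rowP/(_ i): aE; rewrite !mxE.
Qed.

Lemma cover_rank p : E p -> rank_locus 3 F (cover p).
Proof.
move=> pE; have [a a0 aE] := coords_ofP (coverP pE); rewrite /rank_locus.
rewrite -(mxrank_scale_nz _ a0) scaler_sumr.
have -> : \sum_m a *: (rep (cover p) 0 m *: Fm m) = symprod (rep p) (rep (sigma p)).
  rewrite (pairingE pE); apply: eq_bigr => m _.
  by rewrite aE mxE scalerA.
rewrite ltnS; apply: leq_trans (mxrank_add _ _) _.
by apply: (@leq_add _ _ 1 1); apply: mulmx_max_rank.
Qed.

(** A nonzero coordinate of [l] is a nonzero diagonal entry of its matrix, so the form factors; its
    two factors are a pair of the zero locus with product [l]. *)
Lemma cover_surjective l : rank_locus 3 F l -> exists2 p, E p & cover p = l.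
Proof.
move=> lX; have /rV0Pn[i li] := rep_neq0 l.
have [||u [v uv]] := @rank2_symprod k n _ i two_neq0 _ _ lX.
- rewrite linear_sum; apply: eq_bigr => m _; by rewrite linearZ /= Fsym.
- by rewrite normalized_diag -mulr_natl mulf_neq0.
have uvi j : u 0 j * v 0 j = rep l 0 j by apply: symprod_diag; rewrite -uv.
have u0 : u != 0.
  by apply: contraNneq li => u0; rewrite -uvi u0 mxE mul0r.
have v0 : v != 0.
  by apply: contraNneq li => v0; rewrite -uvi v0 mxE mulr0.
have [pE sE] : E (point u0) /\ point v0 = sigma (point u0).
  apply/relE/(annihilates_coords _ (coords_of_point u0) (coords_of_point v0)).
  by apply/(annihilatesP two_neq0 xF Fsym); exists (fun m => rep l 0 m).
exists (point u0) => //; apply: coords_of_inj (coverP pE) _.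
rewrite /pairing -sE.
have [a a0 aE] := coords_ofP (coords_of_point u0).
have [b b0 bE] := coords_ofP (coords_of_point v0).
have lE : (a * b) *: hadamard (rep (point u0)) (rep (point v0)) = rep l.
  by rewrite -hadamard_scale -aE -bE; apply/rowP => j; rewrite mxE.
have ab0 : (a * b)^-1 != 0 by rewrite invr_eq0 mulf_neq0.

have -> : hadamard (rep (point u0)) (rep (point v0)) = (a * b)^-1 *: rep l.
  by rewrite -lE scalerA mulVf ?scale1r // mulf_neq0.
exact: coords_of_scale ab0 (coords_of_rep l).
Qed.

(** Equal images make the two products of linear forms proportional, and unique factorization finds
    [q] among the factors [p] and [sigma p]. *)
Lemma cover_fibre p q : E p -> E q -> cover p = cover q -> p = q \/ sigma p = q.
Proof.
move=> pE qE pq; have [a a0 aE] := coords_ofP (coverP pE).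
have [b b0 bE] := coords_ofP (coverP qE).
have abE : pairing p = (a / b) *: pairing q.
  by rewrite aE bE pq scalerA divfK.
have : symprod (rep p) (rep (sigma p)) = (a / b) *: symprod (rep q) (rep (sigma q)).
  rewrite (pairingE pE) (pairingE qE) abE scaler_sumr; apply: eq_bigr => m _.
  by rewrite mxE scalerA.
case/(symprod_factor two_neq0) => h; [left|right]; apply: proj_eqP;
  by apply: eqmx_rV h; apply: rep_neq0.
Qed.

Lemma cover_double : at_most_double_cover E (rank_locus 3 F) cover.
Proof.
split; [exact: cover_morphism | exact: cover_rank | exact: cover_surjective |].
move=> p1 p2 p3 E1 E2 E3 e12 e23.
case: (cover_fibre E1 E2 e12) => [->|<-]; first by constructor 1.
by case: (cover_fibre E1 E3 (etrans e12 e23)) => <-; [constructor 2|constructor 3].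
Qed.

End DoubleCover.

(** * Assembly in an arbitrary basis of degree one *)

Lemma clifford_G1 (k : closedFieldType) (n : nat) (S : connGrAlg k)
    (F : n.-tuple 'M[k]_n) (m : nat) (x : 'I_n -> S) :
  (2 : k) != 0 -> lin_indep_symmetric F -> is_clifford F S ->
  pd_le (triv_grmod S) m -> is_basis (homog_part S 1) x ->
  exists (E : projSpace k n -> Prop) (sigma : projSpace k n -> projSpace k n),
    G1_with x E sigma /\ forall p, E p -> sigma (sigma p) = p.
Proof.
move=> two [_ Fsym] [z [y [z1 _ Szy]]] pd [x1 xb].
have [A zE] : exists A : 'I_n -> 'rV[k]_n, forall i, z i = \sum_j A i 0 j *: x j.
  apply: (fin_all_exists (P := fun i (c : 'rV[k]_n) => z i = \sum_j c 0 j *: x j)) => i.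
  by have [c [cE _]] := xb _ (z1 i); exists c.
pose B := \matrix_i A i.
(* A row relation of [B] would be a linear relation between the Clifford generators, which
   [clifford_free] excludes. *)
have uB : B \in unitmx.
  rewrite -row_free_unit -kermx_eq0; apply: contraT => /rowV0Pn[u /sub_kermxP uB u0].
  case/eqP: u0; apply/rowP => i; rewrite mxE; apply: (clifford_free Szy) i.
  under eq_bigr => i _ do rewrite zE scaler_sumr.
  rewrite exchange_big big1 //= => j _; under eq_bigr do rewrite scalerA.
  rewrite -scaler_suml; move/rowP/(_ j): uB; rewrite !mxE.
  by under eq_bigr do rewrite mxE; move=> ->; rewrite scale0r.
have xE : x = fun i => \sum_j invmx B i j *: z j.
  apply: boolp.funext => i; under eq_bigr => j _ do rewrite zE scaler_sumr.
  rewrite exchange_big (bigD1 i) //= [X in _ + X]big1 => [|l li].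
    under eq_bigr do rewrite scalerA.
    rewrite -scaler_suml addr0; have /matrixP/(_ i i) := mulVmx uB.
    by rewrite !mxE eqxx; under eq_bigr do rewrite [B _ _]mxE; move=> ->; rewrite scale1r.
  under eq_bigr do rewrite scalerA.
  rewrite -scaler_suml; have /matrixP/(_ i l) := mulVmx uB.
  rewrite !mxE eq_sym (negPf li); under eq_bigr do rewrite [B _ _]mxE.
  by move=> ->; rewrite scale0r.
have uB' : invmx B \in unitmx by rewrite unitmx_inv.
have := quad_dual_basis_change uB' (clifford_quad_dual Szy two Fsym).
rewrite -xE => /(G1_quad_dual two); apply.
  by move=> l; rewrite !trmx_mul trmxK Fsym mulmxA.
(* The transformed quadrics at [v] are the original ones at [v *m invmx B], a nonzero vector. *)
move=> v v0; have vB0 : v *m invmx B != 0.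
  apply: contraNneq v0 => z0.
  by rewrite -[v]mulmx1 -(mulVmx uB) mulmxA z0 mul0mx.
have [i vi] : exists i, (v *m invmx B) 0 i != 0 by apply/rV0Pn.
have [l lE] := clifford_base_point_free Szy z1 two pd vi.
exists l; rewrite quad_formE !mulmxA -mulmxA -trmx_mul -quad_formE; exact: lE.
Qed.

Theorem theorem4p5 (k : closedFieldType) (char_k : [pchar k] =i pred0)
    (n : nat) (S : connGrAlg k) (hS : clifford_quantum_poly n S) :
  (forall x : 'I_n -> S, is_basis (homog_part S 1) x ->
     exists (E : projSpace k n -> Prop) (sigma : projSpace k n -> projSpace k n),
       G1_with x E sigma /\ forall p, E p -> sigma (sigma p) = p)
  /\
  (forall (F : n.-tuple 'M[k]_n) (x : 'I_n -> S),
     lin_indep_symmetric F -> normalized F -> is_SF F x ->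
     forall (E : projSpace k n -> Prop) (sigma : projSpace k n -> projSpace k n),
       G1_with x E sigma ->
       exists2 Phi : projSpace k n -> projSpace k n,
         forall p, E p -> coords_of (hadamard (rep p) (rep (sigma p))) (Phi p) &
         at_most_double_cover E (rank_locus 3 F) Phi).
Proof.
have two : (2 : k) != 0 by rewrite (iffLR (pcharf0P k) char_k).
split=> [x xb|F x [_ Fsym] Fnorm [_ Sx] E sigma G1].
  have [Q [F [hF FS]]] := hS.
  (* Taking [m = n] in [gldim_eq] bounds the projective dimension of the trivial module. *)
  by apply: (clifford_G1 two hF FS _ xb); apply: (iffRL (qp_gldim Q n)).
have xF := SF_quad_dual Sx two Fsym Fnorm.
exists (cover sigma).
  by move=> p pE; apply: (coverP two Fsym Fnorm xF G1).
exact: (cover_double two Fsym Fnorm xF G1).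
Qed.
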